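(* Let $k\geq 2$ be arbitrary (so $k-1\geq 1$). There exists a $\mathbf{0}'$-computable instance $I_k^1$ of $\mathsf{RT}_k^1$ such that for every instance $I_{k-1}^1$ of $\mathsf{RT}_{k-1}^1$ there exists a non trivial solution $G$ to $I_{k-1}^1$ such that $G$ does not compute any non trivial solution to $I_k^1$.
   Context: An instance of $\mathsf{RT}_k^1$ is a function $c:\mathbb{N}\to\{1,\dots,k\}$. A non trivial solution to such an instance is an infinite set $H\subseteq\mathbb{N}$ on which $c$ is constant. $\mathbf{0}'$ denotes the halting problem; ''$G$ computes $H$'' means $H\le_T G$. *)

(* Defs.v *)
From Stdlib Require Import Arith Cantor List.

(* Sets of natural numbers are predicates [nat -> Prop]; (partial) functions on
   [nat] are represented by their graphs [nat -> nat -> Prop]. *)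

Notation "⟨ x , y ⟩" := (Cantor.to_nat (x, y)) (at level 0).

(* Programs for unary partial functions; several arguments are packed with the
   Cantor pairing. *)
Inductive code : Set :=
| cZero | cSucc | cFst | cSnd | cOracle
| cPair (f g : code)
| cComp (f g : code)
| cPrec (f g : code)
| cMu (f : code).

(* [eval O e x y]: the program [e] with oracle [O] halts on [x] with output [y].
   - [cComp f g] is [f] after [g];
   - [h := cPrec f g] satisfies h⟨a,0⟩ = f(a) and
     h⟨a,n+1⟩ = g⟨a,⟨n,h⟨a,n⟩⟩⟩;
   - [cMu f] maps [a] to the least [n] with f⟨a,n⟩ = 0, all the values
     f⟨a,m⟩ for m < n being defined. *)
Fixpoint eval (O : nat -> nat -> Prop) (e : code) : nat -> nat -> Prop :=
  match e with
  | cZero => fun _ y => y = 0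
  | cSucc => fun x y => y = S x
  | cFst => fun x y => y = fst (Cantor.of_nat x)
  | cSnd => fun x y => y = snd (Cantor.of_nat x)
  | cOracle => O
  | cPair f g => fun x y =>
      exists a b, eval O f x a /\ eval O g x b /\ y = ⟨a, b⟩
  | cComp f g => fun x y => exists z, eval O g x z /\ eval O f z y
  | cPrec f g => fun x y =>
      let (a, n) := Cantor.of_nat x in
      nat_rect (fun _ => nat -> Prop)
        (eval O f a)
        (fun m h z => exists b, h b /\ eval O g ⟨a, ⟨m, b⟩⟩ z)
        n y
  | cMu f => fun a n =>
      eval O f ⟨a, n⟩ 0 /\
      forall m, m < n -> exists v, eval O f ⟨a, m⟩ (S v)
  end.

(* The oracle given by a set is its (total) characteristic function. *)
Definition char (A : nat -> Prop) : nat -> nat -> Prop :=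
  fun x y => (A x /\ y = 1) \/ (~ A x /\ y = 0).

Definition computable_in (A : nat -> Prop) (F : nat -> nat -> Prop) : Prop :=
  exists e : code, forall x y, eval (char A) e x y <-> F x y.

Definition turing_le (A B : nat -> Prop) : Prop := computable_in B (char A).

Fixpoint encode (e : code) : nat :=
  match e with
  | cZero => ⟨0, 0⟩
  | cSucc => ⟨1, 0⟩
  | cFst => ⟨2, 0⟩
  | cSnd => ⟨3, 0⟩
  | cOracle => ⟨4, 0⟩
  | cPair f g => ⟨5, ⟨encode f, encode g⟩⟩
  | cComp f g => ⟨6, ⟨encode f, encode g⟩⟩
  | cPrec f g => ⟨7, ⟨encode f, encode g⟩⟩
  | cMu f => ⟨8, encode f⟩
  end.

(* Programs are run here with the empty set as oracle, i.e. as ordinary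
   (oracle-free) programs. *)
Definition halting_problem : nat -> Prop :=
  fun n => exists (e : code) (x : nat), n = ⟨encode e, x⟩ /\
    exists y, eval (char (fun _ => False)) e x y.

Definition infinite (H : nat -> Prop) : Prop :=
  ~ exists l : list nat, forall n, H n -> In n l.

Definition RT1_instance (k : nat) (c : nat -> nat) : Prop :=
  forall n, 1 <= c n <= k.

Definition RT1_solution (c : nat -> nat) (H : nat -> Prop) : Prop :=
  infinite H /\ forall x y, H x -> H y -> c x = c y.

Lemma encode_inj (e e' : code) : encode e = encode e' -> e = e'.
Proof.
  revert e'; induction e; destruct e'; cbn [encode]; intro E;
    apply Cantor.to_nat_inj, pair_equal_spec in E; destruct E as [T E];
    try discriminate T; try reflexivity;
    try (apply Cantor.to_nat_inj, pair_equal_spec in E; destruct E as [E1 E2]);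
    f_equal; auto.
Qed.

Lemma char_functional (A : nat -> Prop) (x y z : nat) :
  char A x y -> char A x z -> y = z.
Proof. unfold char; intuition congruence. Qed.

Lemma eval_functional (O : nat -> nat -> Prop) (e : code) :
  (forall x y z, O x y -> O x z -> y = z) ->
  forall x y z, eval O e x y -> eval O e x z -> y = z.
Proof.
  intro HO; induction e as [| | | | |f IHf g IHg|f IHf g IHg|f IHf g IHg|f IHf];
    cbn [eval]; try (intros; congruence).
  - exact HO.
  - intros x y z (a & b & Ha & Hb & ->) (a' & b' & Ha' & Hb' & ->).
    rewrite (IHf _ _ _ Ha Ha'), (IHg _ _ _ Hb Hb'); reflexivity.
  - intros x y z (a & Ha & Hy) (b & Hb & Hz).
    rewrite (IHg _ _ _ Hb Ha) in Hz; eauto.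
  - intros x; destruct (Cantor.of_nat x) as [a n].
    induction n as [|n IHn]; cbn [nat_rect].
    + apply IHf.
    + intros y z (b & Hb & Hy) (b' & Hb' & Hz).
      rewrite (IHn _ _ Hb' Hb) in Hz; eauto.
  - intros x y z [Hy Ly] [Hz Lz].
    destruct (Nat.lt_trichotomy y z) as [L|[L|L]]; [|exact L|].
    + destruct (Lz _ L) as [v Hv]; discriminate (IHf _ _ _ Hy Hv).
    + destruct (Ly _ L) as [v Hv]; discriminate (IHf _ _ _ Hz Hv).
Qed.

Lemma turing_le_refl (A : nat -> Prop) : turing_le A A.
Proof. exists cOracle; intros x y; reflexivity. Qed.

(* Main.v *)
Require Import Defs.
From Stdlib Require Import Arith Cantor List Lia Bool Classical ClassicalEpsilon
  FunctionalExtensionality PropExtensionality IndefiniteDescription.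

(* An increasing sequence of blocks [[x, x + g x]], where [g ≤_T 0'] dominates every
   computable function, is coloured cyclically with the [k] colours. Hence, if [f] is
   computable or only dominated by a computable function, then for every colour [j]
   some interval [[x, f x]] is monochromatic of colour [j]; on the other hand, a set
   computing an infinite homogeneous set of colour [a] computes, for every [j <> a],
   an [f] such that [f x >= x] never has colour [j].

   Given [J] with [k - 1] colours, Mathias forcing builds simultaneously sets [G i]
   contained in the colour classes of [J], with hyperimmune-free reservoirs. For a
   colour [j] and programs [e i] one asks whether for every [x] and every cover of the
   reservoir by sets [Z i], one for each colour of [J], some [e i] can be made to
   converge on [x] by adding to [G i] elements of [Z i]. If so, compactness bounds the
   outputs by a function computable in the reservoir, so that, for the cover given by
   [J] itself, some output falls inside a long block of colour [j]. Otherwise the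
   hyperimmune-free basis theorem yields a cover one of whose sets is a reservoir
   forcing divergence. If no [G i] were as wanted, each would compute a solution, of
   colour [a i] say, and a [j] different from the [k - 1] colours [a i] would
   contradict the requirement for [j]. *)

(** * Computable functions *)

Notation π1 x := (fst (Cantor.of_nat x)).
Notation π2 x := (snd (Cantor.of_nat x)).

Definition oracle (b : nat -> bool) : nat -> nat -> Prop :=
  char (fun n => b n = true).

Definition comp (b : nat -> bool) (f : nat -> nat) : Prop :=
  exists e, forall x, eval (oracle b) e x (f x).

Definition dec (b : nat -> bool) (P : nat -> bool) : Prop :=
  comp b (fun v => Nat.b2n (P v)).

Lemma pi1_pair a b : π1 ⟨a, b⟩ = a.
Proof. now rewrite Cantor.cancel_of_to. Qed.

Lemma pi2_pair a b : π2 ⟨a, b⟩ = b.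
Proof. now rewrite Cantor.cancel_of_to. Qed.

Ltac proj := cbv beta in *; repeat (rewrite ?pi1_pair, ?pi2_pair in *).

Lemma pair_eta x : ⟨π1 x, π2 x⟩ = x.
Proof. now rewrite <- surjective_pairing, Cantor.cancel_to_of. Qed.

Global Opaque Cantor.to_nat Cantor.of_nat.

Lemma oracle_functional b x y z : oracle b x y -> oracle b x z -> y = z.
Proof. apply char_functional. Qed.

Lemma eval_oracle_functional b e x y z :
  eval (oracle b) e x y -> eval (oracle b) e x z -> y = z.
Proof. apply eval_functional, oracle_functional. Qed.

Lemma char_bool (A : nat -> Prop) :
  exists b, char A = oracle b /\ forall n, A n <-> b n = true.
Proof.
  exists (fun n => if excluded_middle_informative (A n) then true else false).
  assert (E : forall n, A n <->
    (if excluded_middle_informative (A n) then true else false) = true).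
  { intro n; destruct (excluded_middle_informative (A n)); easy. }
  split; [|exact E].
  unfold oracle; f_equal; extensionality n; apply propositional_extensionality, E.
Qed.

Lemma comp_ext b f g : (forall x, f x = g x) -> comp b f -> comp b g.
Proof. intros E; now replace g with f by (extensionality x; auto). Qed.

Lemma dec_ext b (f g : nat -> bool) : (forall x, f x = g x) -> dec b f -> dec b g.
Proof. intros E; now replace g with f by (extensionality x; auto). Qed.

Lemma comp_zero b : comp b (fun _ => 0).
Proof. exists cZero; easy. Qed.

Lemma comp_fst b : comp b (fun x => π1 x).
Proof. exists cFst; easy. Qed.

Lemma comp_snd b : comp b (fun x => π2 x).
Proof. exists cSnd; easy. Qed.

Lemma comp_pair b f g : comp b f -> comp b g -> comp b (fun v => ⟨f v, g v⟩).
Proof. intros [e He] [d Hd]; exists (cPair e d); intro x; cbn; eauto. Qed.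

Lemma comp_id b : comp b (fun x => x).
Proof.
  apply comp_ext with (fun x => ⟨π1 x, π2 x⟩); [apply pair_eta|].
  apply comp_pair; [apply comp_fst | apply comp_snd].
Qed.

Lemma comp_comp b f g : comp b f -> comp b g -> comp b (fun v => f (g v)).
Proof. intros [e He] [d Hd]; exists (cComp e d); intro x; cbn; eauto. Qed.

Lemma comp_pi1 b f : comp b f -> comp b (fun v => π1 (f v)).
Proof. apply (comp_comp b (fun v => π1 v)), comp_fst. Qed.

Lemma comp_pi2 b f : comp b f -> comp b (fun v => π2 (f v)).
Proof. apply (comp_comp b (fun v => π2 v)), comp_snd. Qed.

Lemma comp_S b f : comp b f -> comp b (fun v => S (f v)).
Proof. apply (comp_comp b S); exists cSucc; easy. Qed.

Lemma comp_const b n : comp b (fun _ => n).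
Proof. induction n; [apply comp_zero | now apply comp_S]. Qed.

(** The base, the step and the bound may all depend on [v]: the recursion is run on [⟨v, n v⟩],
    whose first component [cPrec] carries along. *)
Lemma comp_rec b f g n :
  comp b f -> comp b (fun q => g (π1 q) (π1 (π2 q)) (π2 (π2 q))) -> comp b n ->
  comp b (fun v => nat_rect (fun _ => nat) (f v) (g v) (n v)).
Proof.
  intros [e He] [d Hd] Hn.
  apply (comp_ext b (fun v => (fun q => nat_rect (fun _ => nat) (f (π1 q))
    (g (π1 q)) (π2 q)) ⟨v, n v⟩)); [intro; now proj|].
  apply (comp_comp b (fun q => nat_rect (fun _ => nat) (f (π1 q)) (g (π1 q)) (π2 q)));
    [|now apply comp_pair; [apply comp_id|]].
  exists (cPrec e d); intro q; cbn [eval].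
  rewrite (surjective_pairing (Cantor.of_nat q)); cbn [fst snd].
  generalize (π1 q) (π2 q); clear q n Hn; intros a n.
  induction n as [|n IH]; cbn; [apply He|].
  eexists; split; [exact IH|].
  specialize (Hd ⟨a, ⟨n, nat_rect (fun _ => nat) (f a) (g a) n⟩⟩); now proj.
Qed.

Lemma comp_case b f g n :
  comp b n -> comp b f -> comp b (fun q => g (π1 q) (π2 q)) ->
  comp b (fun v => match n v with 0 => f v | S m => g v m end).
Proof.
  intros Hn Hf Hg.
  apply comp_ext with
    (fun v => nat_rect (fun _ => nat) (f v) (fun m _ => g v m) (n v));
    [intro v; now destruct (n v)|].
  apply (comp_rec b f (fun v m _ => g v m)); auto.
  apply (comp_ext b (fun q => (fun p => g (π1 p) (π2 p)) ⟨π1 q, π1 (π2 q)⟩));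
    [intro; now proj|].
  apply (comp_comp b (fun p => g (π1 p) (π2 p))); [exact Hg|].
  apply comp_pair; [|apply comp_pi1]; [apply comp_fst|apply comp_snd].
Qed.

Lemma comp_app2 b h f g :
  comp b (fun q => h (π1 q) (π2 q)) -> comp b f -> comp b g ->
  comp b (fun v => h (f v) (g v)).
Proof.
  intros Hh Hf Hg.
  apply (comp_ext b (fun v => (fun p => h (π1 p) (π2 p)) ⟨f v, g v⟩));
    [intro; now proj|].
  now apply (comp_comp b (fun p => h (π1 p) (π2 p))), comp_pair.
Qed.

Lemma comp_oracle b f : comp b f -> dec b (fun v => b (f v)).
Proof.
  apply (comp_comp b (fun x => Nat.b2n (b x))).
  exists cOracle; intro x; cbn; unfold oracle, char.
  destruct (b x); [now left | now right].
Qed.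

Lemma comp_if b P f g :
  dec b P -> comp b f -> comp b g -> comp b (fun v => if P v then f v else g v).
Proof.
  intros HP Hf Hg.
  apply comp_ext with
    (fun v => match Nat.b2n (P v) with 0 => g v | S _ => f v end);
    [intro v; now destruct (P v)|].
  apply (comp_case b g (fun v _ => f v)); auto.
  now apply (comp_comp b f), comp_fst.
Qed.

Lemma comp_pred b f : comp b f -> comp b (fun v => pred (f v)).
Proof.
  intro Hf; apply comp_ext with (fun v => match f v with 0 => 0 | S m => m end);
    [intro v; now destruct (f v)|].
  apply (comp_case b (fun _ => 0) (fun _ m => m)); auto using comp_const, comp_snd.
Qed.

Lemma comp_add b f g : comp b f -> comp b g -> comp b (fun v => f v + g v).
Proof.
  intros Hf Hg.
  apply comp_ext with (fun v => nat_rect (fun _ => nat) (f v) (fun _ r => S r) (g v)).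
  { intro v; induction (g v); cbn; lia. }
  apply (comp_rec b f (fun _ _ r => S r)); auto using comp_S, comp_pi2, comp_id.
Qed.

Lemma comp_sub b f g : comp b f -> comp b g -> comp b (fun v => f v - g v).
Proof.
  intros Hf Hg.
  apply comp_ext with (fun v => nat_rect (fun _ => nat) (f v) (fun _ r => pred r) (g v)).
  { intro v; induction (g v); cbn; lia. }
  apply (comp_rec b f (fun _ _ r => pred r)); auto using comp_pred, comp_pi2, comp_id.
Qed.

Lemma comp_pow2 b f : comp b f -> comp b (fun v => 2 ^ f v).
Proof.
  intros Hf.
  apply comp_ext with (fun v => nat_rect (fun _ => nat) 1 (fun _ r => r + r) (f v)).
  { intro v; induction (f v); cbn in *; lia. }
  apply (comp_rec b (fun _ => 1) (fun _ _ r => r + r));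
    auto using comp_const, comp_add, comp_pi2, comp_id.
Qed.

Lemma dec_neg b P : dec b P -> dec b (fun v => negb (P v)).
Proof.
  intro H; eapply comp_ext; [|exact (comp_if b P (fun _ => 0) (fun _ => 1) H
    (comp_const _ _) (comp_const _ _))].
  intro v; cbn; now destruct (P v).
Qed.

Lemma dec_and b P Q : dec b P -> dec b Q -> dec b (fun v => P v && Q v).
Proof.
  intros H K; eapply comp_ext;
    [|exact (comp_if b P (fun v => Nat.b2n (Q v)) (fun _ => 0) H K (comp_const _ _))].
  intro v; cbn; now destruct (P v).
Qed.

Lemma dec_or b P Q : dec b P -> dec b Q -> dec b (fun v => P v || Q v).
Proof.
  intros H K; eapply comp_ext;
    [|exact (comp_if b P (fun _ => 1) (fun v => Nat.b2n (Q v)) H (comp_const _ _) K)].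
  intro v; cbn; now destruct (P v).
Qed.

Lemma dec_le b f g : comp b f -> comp b g -> dec b (fun v => f v <=? g v).
Proof.
  intros H K; apply comp_ext with (fun v => 1 - (f v - g v));
    auto using comp_sub, comp_const.
  intro v; destruct (Nat.leb_spec (f v) (g v)); cbn [Nat.b2n]; lia.
Qed.

Lemma dec_lt b f g : comp b f -> comp b g -> dec b (fun v => f v <? g v).
Proof. intros; apply (dec_le b (fun v => S (f v))); auto using comp_S. Qed.

Lemma dec_eq b f g : comp b f -> comp b g -> dec b (fun v => f v =? g v).
Proof.
  intros H K; apply dec_ext with (fun v => (f v <=? g v) && (g v <=? f v));
    auto using dec_and, dec_le.
  intro v; destruct (Nat.eqb_spec (f v) (g v)), (Nat.leb_spec (f v) (g v)),
    (Nat.leb_spec (g v) (f v)); cbn; lia.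
Qed.

Lemma dec_const b (c : bool) : dec b (fun _ => c).
Proof. exact (comp_const b (Nat.b2n c)). Qed.

(** * Bounded quantifiers, finite sets coded in binary, and search *)

Fixpoint bex (P : nat -> bool) (n : nat) : bool :=
  match n with 0 => false | S m => P m || bex P m end.

Definition ball (P : nat -> bool) (n : nat) : bool :=
  negb (bex (fun m => negb (P m)) n).

Lemma bex_spec P n : bex P n = true <-> exists m, m < n /\ P m = true.
Proof.
  induction n as [|n IH]; cbn.
  - split; [easy | intros (m & ? & _); lia].
  - rewrite orb_true_iff, IH; split.
    + intros [H|(m & L & H)]; eauto with arith.
    + intros (m & L & H); destruct (Nat.eq_dec m n) as [->|]; [now left|].
      right; exists m; split; [lia | exact H].
Qed.

Lemma ball_spec P n : ball P n = true <-> forall m, m < n -> P m = true.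
Proof.
  unfold ball; rewrite negb_true_iff, <- not_true_iff_false, bex_spec; split.
  - intros H m L; destruct (P m) eqn:E; auto.
    exfalso; apply H; exists m; now rewrite E.
  - intros H (m & L & E); now rewrite (H m L) in E.
Qed.

Lemma dec_bex b (P : nat -> nat -> bool) n :
  dec b (fun q => P (π1 q) (π2 q)) -> comp b n -> dec b (fun v => bex (P v) (n v)).
Proof.
  intros HP Hn.
  apply comp_ext with (fun v => nat_rect (fun _ => nat) 0
    (fun m r => if P v m then 1 else r) (n v)).
  { intro v; induction (n v) as [|m IH]; cbn; [easy|rewrite IH].
    now destruct (P v m). }
  apply (comp_rec b (fun _ => 0) (fun v m r => if P v m then 1 else r));
    auto using comp_const.
  apply (comp_if b (fun q => P (π1 q) (π1 (π2 q))));
    auto using comp_const, comp_pi2, comp_id.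
  apply (comp_app2 b (fun x y => Nat.b2n (P x y)));
    auto using comp_pi1, comp_pi2, comp_id.
Qed.

Lemma dec_ball b (P : nat -> nat -> bool) n :
  dec b (fun q => P (π1 q) (π2 q)) -> comp b n -> dec b (fun v => ball (P v) (n v)).
Proof.
  intros HP Hn; apply dec_neg.
  apply (dec_bex b (fun v m => negb (P v m))); auto using dec_neg.
Qed.

Lemma dec_existsb {A} b (P : A -> nat -> bool) l :
  (forall i, dec b (P i)) -> dec b (fun v => existsb (fun i => P i v) l).
Proof.
  intros HP; induction l; cbn [existsb]; auto using dec_const, dec_or.
Qed.

Lemma dec_forallb {A} b (P : A -> nat -> bool) l :
  (forall i, dec b (P i)) -> dec b (fun v => forallb (fun i => P i v) l).
Proof.
  intros HP; induction l; cbn [forallb]; auto using dec_const, dec_and.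
Qed.

Lemma dec_testbit b f g :
  comp b f -> comp b g -> dec b (fun v => Nat.testbit (f v) (g v)).
Proof.
  assert (odd_dec : forall f, comp b f -> dec b (fun v => Nat.odd (f v))).
  { clear; intros f Hf.
    apply comp_ext with (fun v => nat_rect (fun _ => nat) 0
      (fun _ r => match r with 0 => 1 | S _ => 0 end) (f v)).
    { intro v; induction (f v) as [|n IH]; cbn [nat_rect]; [easy|rewrite IH].
      rewrite Nat.odd_succ, <- Nat.negb_odd; now destruct (Nat.odd n). }
    apply (comp_rec b (fun _ => 0) (fun _ _ r => match r with 0 => 1 | S _ => 0 end));
      auto using comp_const.
    apply (comp_case b (fun _ => 1) (fun _ _ => 0));
      auto using comp_const, comp_pi2, comp_id. }
  assert (half_comp : forall f, comp b f -> comp b (fun v => Nat.div2 (f v))).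
  { clear - odd_dec; intros f Hf.
    (* [Nat.div2 n] is the number of odd numbers below [n]. *)
    apply comp_ext with (fun v => nat_rect (fun _ => nat) 0
      (fun m r => r + Nat.b2n (Nat.odd m)) (f v)).
    { intro v; induction (f v) as [|n IH]; cbn [nat_rect]; [easy|rewrite IH].
      pose proof (Nat.div2_odd n) as E1; pose proof (Nat.div2_odd (S n)) as E2.
      rewrite Nat.odd_succ, <- Nat.negb_odd in E2.
      destruct (Nat.odd n); cbn [Nat.b2n negb] in *; lia. }
    apply (comp_rec b (fun _ => 0) (fun _ m r => r + Nat.b2n (Nat.odd m)));
      auto using comp_const.
    apply comp_add; auto using comp_pi2, comp_id.
    apply odd_dec; auto using comp_pi1, comp_pi2, comp_id. }
  intros Hf Hg.
  apply dec_ext with (fun v => Nat.odd (nat_rect (fun _ => nat) (f v)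
    (fun _ r => Nat.div2 r) (g v))).
  { intro v; rewrite Nat.testbit_odd; reflexivity. }
  apply odd_dec, (comp_rec b f (fun _ _ r => Nat.div2 r));
    auto using comp_pi2, comp_id.
Qed.

Lemma comp_mu b (P : nat -> nat -> bool) :
  dec b (fun q => P (π1 q) (π2 q)) -> (forall x, exists n, P x n = true) ->
  exists f, comp b f /\ forall x, P x (f x) = true.
Proof.
  (* [cMu] looks for the value [0], so [e] decides the negation of [P]; its output is the least
     witness, whence [least]. *)
  intros [e He]%dec_neg Hex.
  assert (least : forall x, exists n, P x n = true /\ forall m, m < n -> P x m = false).
  { intro x; destruct (Hex x) as [n Hn].
    induction n as [n IH] using lt_wf_ind.
    destruct (classic (exists m, m < n /\ P x m = true)) as [(m & L & Hm)|N]; eauto.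
    exists n; split; [exact Hn|]; intros m L.
    apply not_true_iff_false; intro; apply N; eauto. }
  destruct (functional_choice _ least) as [f Hf].
  exists f; split; [|intro x; apply Hf].
  exists (cMu e); intro x; destruct (Hf x) as [Hx Lx]; split.
  - specialize (He ⟨x, f x⟩); proj; now rewrite Hx in He.
  - intros m L; exists 0; specialize (He ⟨x, m⟩); proj; now rewrite Lx in He.
Qed.

(* The oracle [a] is replaced in the program by a program deciding it. *)
Lemma comp_trans a b f : comp a f -> dec b a -> comp b f.
Proof.
  intros [e He] [d Hd].
  assert (orc : forall x y, oracle a x y <-> eval (oracle b) d x y).
  { intros x y; specialize (Hd x).
    assert (E : oracle a x y <-> y = Nat.b2n (a x)).
    { unfold oracle, char; destruct (a x); cbn; intuition congruence. }
    rewrite E; split; [now intros -> | intro; eapply eval_oracle_functional; eauto]. }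
  enough (sub : exists e', forall x y, eval (oracle b) e' x y <-> eval (oracle a) e x y)
    by (destruct sub as [e' H]; exists e'; intro x; apply H, He).
  clear He Hd f.
  induction e as [| | | | |f [f' Hf] g [g' Hg]|f [f' Hf] g [g' Hg]|f [f' Hf] g [g' Hg]|f [f' Hf]].
  - now exists cZero.
  - now exists cSucc.
  - now exists cFst.
  - now exists cSnd.
  - exists d; intros; symmetry; apply orc.
  - exists (cPair f' g'); intros x y; cbn [eval].
    split; intros (u & v & ?); exists u, v; rewrite ?Hf, ?Hg in *; auto.
  - exists (cComp f' g'); intros x y; cbn [eval].
    split; intros (u & ?); exists u; rewrite ?Hf, ?Hg in *; auto.
  - exists (cPrec f' g'); intros x y; cbn [eval].
    destruct (Cantor.of_nat x) as [u n]; revert y.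
    induction n as [|n IH]; cbn; [apply Hf|].
    intro y; split; intros (v & ?); exists v; rewrite ?IH, ?Hg in *; auto.
  - exists (cMu f'); intros x y; cbn [eval]; rewrite Hf.
    split; intros [H L]; (split; [exact H|]); intros m Hm;
      destruct (L m Hm) as [v Hv]; exists v; rewrite ?Hf in *; auto.
Qed.

(* The value [S (S n)] means that the least zero is [n] (zero is the value [1] of
   [h]), and [1] that an undefined value was met before any zero. *)
Definition search (h : nat -> nat) (s : nat) : nat :=
  nat_rect (fun _ => nat) 0
    (fun m r => match r with
                | 0 => match h m with
                       | 0 => 1
                       | S v => match v with 0 => S (S m) | S _ => 0 end
                       end
                | S k => S k
                end) s.

(* Step-bounded evaluation: [0] stands for "no value yet" and [S y] for the
   value [y]; only the first [s] bits of the oracle are consulted. *)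
Fixpoint evs (e : code) (O : nat -> bool) (s x : nat) : nat :=
  match e with
  | cZero => 1
  | cSucc => S (S x)
  | cFst => S (π1 x)
  | cSnd => S (π2 x)
  | cOracle => if x <? s then S (Nat.b2n (O x)) else 0
  | cPair f g =>
      match evs f O s x with
      | 0 => 0
      | S a => match evs g O s x with 0 => 0 | S b => S ⟨a, b⟩ end
      end
  | cComp f g => match evs g O s x with 0 => 0 | S z => evs f O s z end
  | cPrec f g =>
      nat_rect (fun _ => nat) (evs f O s (π1 x))
        (fun m h => match h with 0 => 0 | S b => evs g O s ⟨π1 x, ⟨m, b⟩⟩ end)
        (π2 x)
  | cMu f => pred (search (fun m => evs f O s ⟨x, m⟩) s)
  end.

(** A nonzero value of [search] is final, and [zero] describes the runs that have met neither a zero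
    nor an undefined value. *)
Lemma search_spec h s n :
  search h s = S (S n) <->
  n < s /\ h n = 1 /\ forall m, m < n -> exists v, h m = S (S v).
Proof.
  assert (zero : forall s, search h s = 0 <-> forall m, m < s -> exists v, h m = S (S v)).
  { clear; intro s; induction s as [|s IH]; cbn.
    - split; [intros _ m L; lia | easy].
    - fold (search h s); destruct (search h s) as [|r].
      + split.
        * intros E m L; destruct (Nat.eq_dec m s) as [->|]; [|apply IH; lia].
          destruct (h s) as [|[|v]]; try discriminate; eauto.
        * intro H; destruct (H s) as [v ->]; auto with arith.
      + split; [easy|]; intro H; exfalso.
        enough (S r = 0) by discriminate; apply IH; auto with arith. }
  induction s as [|s IH]; cbn; [split; [easy | lia]|].
  fold (search h s); destruct (search h s) as [|r] eqn:E.
  - assert (Z := proj1 (zero s) E).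
    destruct (h s) as [|[|v]] eqn:Es; (split; [intro H | intros (L & H & F)]);
      try discriminate.
    all: try (injection H as <-; auto with arith; fail).
    all: destruct (Nat.eq_dec n s) as [->|]; try congruence.
    all: destruct (Z n) as [w ?]; [lia | congruence].
  - rewrite IH; split; [intuition lia|intros (L & H & F)].
    destruct (Nat.eq_dec n s) as [->|]; [|intuition lia].
    now apply zero in F; rewrite F in E.
Qed.

(** The use principle: a run bounded by [s] reads the oracle only below [s], and a larger bound
    never revokes a value. *)
Lemma evs_mono e O O' s s' x y :
  s <= s' -> (forall n, n < s -> O n = O' n) ->
  evs e O s x = S y -> evs e O' s' x = S y.
Proof.
  intros L A; revert x y.
  induction e as [| | | | |f IHf g IHg|f IHf g IHg|f IHf g IHg|f IHf];
    cbn [evs]; intros x y; auto.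
  - destruct (Nat.ltb_spec x s), (Nat.ltb_spec x s'); try lia; now rewrite A.
  - destruct (evs f O s x) eqn:E; [discriminate|]; rewrite (IHf _ _ E).
    destruct (evs g O s x) eqn:E'; [discriminate|]; now rewrite (IHg _ _ E').
  - destruct (evs g O s x) eqn:E; [discriminate|]; rewrite (IHg _ _ E); auto.
  - revert y; induction (π2 x) as [|n IH]; cbn [nat_rect]; [auto|intro y].
    destruct (nat_rect _ _ _ n) eqn:E in |- *; [discriminate|].
    rewrite (IH _ E); auto.
  - intro H; enough (E : search (fun m => evs f O' s' ⟨x, m⟩) s' = S (S y)) by now rewrite E.
    assert (E : search (fun m => evs f O s ⟨x, m⟩) s = S (S y)) by lia.
    apply search_spec in E as (Ly & Hy & F); apply search_spec.
    split; [lia|]; split; [auto|].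
    intros m Lm; destruct (F m Lm) as [v Hv]; eauto.
Qed.

Lemma evs_sound e b s x y : evs e b s x = S y -> eval (oracle b) e x y.
Proof.
  revert x y.
  induction e as [| | | | |f IHf g IHg|f IHf g IHg|f IHf g IHg|f IHf];
    cbn [evs eval]; intros x y; try congruence.
  - destruct (x <? s); [|discriminate]; intros [= <-]; unfold oracle, char.
    destruct (b x); [left | right]; easy.
  - destruct (evs f b s x) eqn:E; [discriminate|].
    destruct (evs g b s x) eqn:E'; [discriminate|]; intros [= <-]; exists n, n0; auto.
  - destruct (evs g b s x) eqn:E; [discriminate|]; eauto.
  - rewrite (surjective_pairing (Cantor.of_nat x)).
    generalize (π1 x) (π2 x); intros a n; revert y; cbn [fst snd].
    induction n as [|n IH]; cbn [nat_rect]; [auto|intro y].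
    destruct (nat_rect _ _ _ n) eqn:E in |- *; [discriminate|]; eauto.
  - intro H.
    assert (E : search (fun m => evs f b s ⟨x, m⟩) s = S (S y)) by lia.
    apply search_spec in E as (Ly & Hy & F); split; [auto|].
    intros m Lm; destruct (F m Lm) as [v Hv]; eauto.
Qed.

Lemma evs_le e b s s' x y : evs e b s x = S y -> s <= s' -> evs e b s' x = S y.
Proof. intros H L; now apply (evs_mono e b b s s'). Qed.

(** Each subcomputation has its own bound; by monotonicity the sum of the bounds serves them all. *)
Lemma evs_complete e b x y :
  eval (oracle b) e x y -> exists s, evs e b s x = S y.
Proof.
  revert x y.
  induction e as [| | | | |f IHf g IHg|f IHf g IHg|f IHf g IHg|f IHf];
    cbn [eval]; intros x y.
  1-4: intros ->; now exists 0.
  - unfold oracle, char; intro H; exists (S x); cbn [evs].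
    destruct (Nat.ltb_spec x (S x)); [|lia]; f_equal.
    destruct (b x); intuition (subst; easy).
  - intros (u & v & [s Hs]%IHf & [t Ht]%IHg & ->); exists (s + t); cbn [evs].
    rewrite (evs_le _ _ _ (s + t) _ _ Hs), (evs_le _ _ _ (s + t) _ _ Ht) by lia.
    reflexivity.
  - intros (u & [s Hs]%IHg & [t Ht]%IHf); exists (s + t); cbn [evs].
    rewrite (evs_le _ _ _ (s + t) _ _ Hs), (evs_le _ _ _ (s + t) _ _ Ht) by lia.
    reflexivity.
  - rewrite (surjective_pairing (Cantor.of_nat x)).
    enough (H : forall a n y,
      nat_rect (fun _ => nat -> Prop) (eval (oracle b) f a)
        (fun m h z => exists c, h c /\ eval (oracle b) g ⟨a, ⟨m, c⟩⟩ z) n y ->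
      exists s, evs (cPrec f g) b s ⟨a, n⟩ = S y).
    { intro K; apply H in K; rewrite pair_eta in K; exact K. }
    clear x y; intros a n; induction n as [|n IH]; cbn [nat_rect]; intro y.
    + intros [s Hs]%IHf; exists s; cbn [evs]; now proj.
    + intros (c & [s Hs]%IH & [t Ht]%IHg); exists (s + t).
      apply (evs_le _ _ _ (s + t)) in Hs; [|lia].
      apply (evs_le _ _ _ (s + t)) in Ht; [|lia].
      cbn [evs] in *; proj; cbn [nat_rect]; now rewrite Hs.
  - intros [[s Hs]%IHf F].
    (* The values before the least zero need a common bound, built up one value at a time. *)
    assert (B : forall k, k <= y -> exists t, forall m, m < k ->
      exists v, evs f b t ⟨x, m⟩ = S (S v)).
    { intro k; induction k as [|k IH]; intro L; [exists 0; lia|].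
      destruct IH as [t Ht]; [lia|].
      destruct (F k) as [v [t' Ht']%IHf]; [lia|].
      exists (t + t'); intros m Lm; destruct (Nat.eq_dec m k) as [->|].
      - exists v; apply (evs_le _ _ _ _ _ _ Ht'); lia.
      - destruct (Ht m) as [w Hw]; [lia|]; exists w; apply (evs_le _ _ _ _ _ _ Hw); lia. }
    destruct (B y (le_n _)) as [t Ht].
    exists (s + t + S y); cbn [evs].
    enough (E : search (fun m => evs f b (s + t + S y) ⟨x, m⟩) (s + t + S y) = S (S y))
      by now rewrite E.
    apply search_spec; split; [lia|]; split; [apply (evs_le _ _ _ _ _ _ Hs); lia|].
    intros m L; destruct (Ht m L) as [w Hw]; exists w; apply (evs_le _ _ _ _ _ _ Hw); lia.
Qed.

(** By induction on the fixed program [e]. The input is made a separate variable [π2 q], since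
    subprograms are run on other inputs. *)
Lemma comp_evs b e (O : nat -> nat -> bool) s n :
  dec b (fun q => O (π1 q) (π2 q)) -> comp b s -> comp b n ->
  comp b (fun v => evs e (O v) (s v) (n v)).
Proof.
  intros HO Hs; revert n.
  enough (H : comp b (fun q => evs e (O (π1 q)) (s (π1 q)) (π2 q))).
  { intros n Hn; apply (comp_app2 b (fun v x => evs e (O v) (s v) x)); auto using comp_id. }
  induction e as [| | | | |f IHf g IHg|f IHf g IHg|f IHf g IHg|f IHf]; cbn [evs].
  - apply comp_const.
  - auto using comp_S, comp_pi2, comp_id.
  - auto using comp_S, comp_pi1, comp_pi2, comp_id.
  - auto using comp_S, comp_pi2, comp_id.
  - apply (comp_if b (fun q => π2 q <? s (π1 q))); auto using comp_const.
    + apply dec_lt; [apply comp_snd|]; apply (comp_comp b s); auto using comp_fst.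
    + apply comp_S, HO.
  - apply (comp_case b (fun _ => 0) (fun q a => match evs g (O (π1 q)) (s (π1 q)) (π2 q)
      with 0 => 0 | S c => S ⟨a, c⟩ end)); auto using comp_const.
    apply (comp_case b (fun _ => 0) (fun q c => S ⟨π2 q, c⟩));
      auto using comp_const, comp_S, comp_pair, comp_pi1, comp_pi2, comp_id.
    apply (comp_app2 b (fun v x => evs g (O v) (s v) x));
      auto using comp_pi1, comp_pi2, comp_id.
  - apply (comp_case b (fun _ => 0) (fun q z => evs f (O (π1 q)) (s (π1 q)) z));
      auto using comp_const.
    apply (comp_app2 b (fun v x => evs f (O v) (s v) x));
      auto using comp_pi1, comp_pi2, comp_id.
  - apply (comp_rec b (fun q => evs f (O (π1 q)) (s (π1 q)) (π1 (π2 q)))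
      (fun q m h => match h with 0 => 0
       | S c => evs g (O (π1 q)) (s (π1 q)) ⟨π1 (π2 q), ⟨m, c⟩⟩ end)).
    + apply (comp_app2 b (fun v x => evs f (O v) (s v) x));
        auto using comp_pi1, comp_pi2, comp_id.
    + apply (comp_case b (fun _ => 0) (fun q c => evs g (O (π1 (π1 q))) (s (π1 (π1 q)))
        ⟨π1 (π2 (π1 q)), ⟨π1 (π2 q), c⟩⟩)); auto using comp_const, comp_pi2, comp_id.
      apply (comp_app2 b (fun v x => evs g (O v) (s v) x));
        auto 8 using comp_pair, comp_pi1, comp_pi2, comp_id.
    + auto using comp_pi2, comp_id.
  - apply comp_pred.
    apply (comp_rec b (fun _ => 0) (fun q m r =>
      match r with
      | 0 => match evs f (O (π1 q)) (s (π1 q)) ⟨π2 q, m⟩ with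
             | 0 => 1
             | S v => match v with 0 => S (S m) | S _ => 0 end
             end
      | S k => S k
      end)); auto using comp_const.
    2: apply (comp_comp b s); auto using comp_fst.
    apply (comp_case b
      (fun q => match evs f (O (π1 (π1 q))) (s (π1 (π1 q))) ⟨π2 (π1 q), π1 (π2 q)⟩ with
             | 0 => 1
             | S v => match v with 0 => S (S (π1 (π2 q))) | S _ => 0 end
             end)
      (fun q r => S r)); auto using comp_S, comp_pi2, comp_id.
    apply (comp_case b (fun _ => 1)
      (fun q v => match v with 0 => S (S (π1 (π2 q))) | S _ => 0 end));
      auto using comp_const.
    + apply (comp_app2 b (fun v x => evs f (O v) (s v) x));
        auto using comp_pair, comp_pi1, comp_pi2, comp_id.
    + apply (comp_case b (fun q => S (S (π1 (π2 (π1 q))))) (fun _ _ => 0));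
        auto 8 using comp_const, comp_S, comp_pi1, comp_pi2, comp_id.
Qed.

(** * Compactness and the hyperimmune-free basis theorem *)

(** Truncation leaves a finite set, which a number below [2 ^ s] can code. *)
Definition mask (s : nat) (Z : nat -> bool) (n : nat) : bool := (n <? s) && Z n.

Lemma mask_ext s Z Z' : (forall n, n < s -> Z n = Z' n) -> mask s Z = mask s Z'.
Proof.
  intro A; extensionality n; unfold mask.
  destruct (Nat.ltb_spec n s); cbn; auto.
Qed.

Lemma evs_mask e Z s x : evs e (mask s Z) s x = evs e Z s x.
Proof.
  assert (A : forall n, n < s -> Z n = mask s Z n).
  { intros n L; unfold mask; destruct (Nat.ltb_spec n s); [easy | lia]. }
  destruct (evs e Z s x) eqn:E.
  - destruct (evs e (mask s Z) s x) eqn:E'; [easy|].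
    apply (evs_mono _ _ Z s s) in E'; [congruence | easy |].
    intros; symmetry; auto.
  - apply (evs_mono _ _ (mask s Z) s s) in E; auto.
Qed.

Lemma bits_of (Z : nat -> bool) s :
  exists σ, σ < 2 ^ s /\ forall n, Nat.testbit σ n = mask s Z n.
Proof.
  revert Z; induction s as [|s IH]; intro Z.
  - exists 0; split; [cbn; lia|]; intro n; now rewrite Nat.bits_0.
  - destruct (IH (fun n => Z (S n))) as (σ & L & H).
    exists (Nat.b2n (Z 0) + 2 * σ); split.
    + rewrite Nat.pow_succ_r'; destruct (Z 0); cbn [Nat.b2n]; lia.
    + intros [|n].
      * apply Nat.add_b2n_double_bit0.
      * assert (E : Nat.div2 (Nat.b2n (Z 0) + 2 * σ) = σ).
        { destruct (Z 0); [apply Nat.div2_succ_double | apply Nat.div2_double]. }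
        change (Nat.testbit (Nat.div2 (Nat.b2n (Z 0) + 2 * σ)) n = mask (S s) Z (S n)).
        rewrite E; apply H.
Qed.

Lemma dependent_choice {A} (R : nat -> A -> A -> Prop) a :
  (forall n x, exists y, R n x y) ->
  exists f, f 0 = a /\ forall n, R n (f n) (f (S n)).
Proof.
  intro H.
  destruct (functional_choice (fun (p : nat * A) y => R (fst p) (snd p) y)) as [g Hg];
    [intros [n x]; apply H|].
  exists (nat_rect (fun _ => A) a (fun n x => g (n, x))).
  split; [easy | intro n; apply (Hg (n, _))].
Qed.

(** Compactness of Cantor space, by König's argument: without a uniform bound, a branch along which
    every bound fails can be followed forever, and its limit contradicts the hypothesis. *)
Lemma fan (B : (nat -> bool) -> nat -> Prop) :
  (forall Z, exists s, B (mask s Z) s) ->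
  exists N, forall Z, exists s, s <= N /\ B (mask s Z) s.
Proof.
  intro H; apply NNPP; intro NB.
  set (Q m (b : nat -> bool) := forall N, exists Z,
    (forall n, n < m -> Z n = b n) /\ forall s, s <= N -> ~ B (mask s Z) s).
  assert (Q0 : Q 0 (fun _ => false)).
  { intro N; apply NNPP; intro F; apply NB; exists N; intro Z.
    apply NNPP; intro F'; apply F; exists Z; split; [lia|].
    intros s L Hs; apply F'; eauto. }
  set (upd (b : nat -> bool) m c := fun n => if n =? m then c else b n : bool).
  (* If both one-bit extensions had bounds, their sum would be a bound for the prefix itself. *)
  assert (QS : forall m b, Q m b -> exists c, Q (S m) (upd b m c)).
  { intros m b Qb; apply NNPP; intro F.
    assert (F' : forall c, exists N, forall Z, (forall n, n < S m -> Z n = upd b m c n) ->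
      exists s, s <= N /\ B (mask s Z) s).
    { intro c; apply NNPP; intro G; apply F; exists c; intro N.
      apply NNPP; intro K; apply G; exists N; intros Z HZ.
      apply NNPP; intro K'; apply K; exists Z; split; [exact HZ|].
      intros s L Hs; apply K'; eauto. }
    destruct (F' true) as [N1 H1], (F' false) as [N2 H2].
    destruct (Qb (N1 + N2)) as (Z & E & HZ).
    assert (EZ : forall n, n < S m -> Z n = upd b m (Z m) n).
    { intros n L; unfold upd; destruct (Nat.eqb_spec n m) as [->|]; [easy|].
      apply E; lia. }
    destruct (Z m);
      [destruct (H1 Z EZ) as (s & L & Hs) | destruct (H2 Z EZ) as (s & L & Hs)];
      apply (HZ s); auto; lia. }
  destruct (dependent_choice (fun m (b b' : nat -> bool) =>
    (forall n, n < m -> b' n = b n) /\ (Q m b -> Q (S m) b')) (fun _ => false))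
    as (f & f0 & Hf).
  { intros m b; destruct (classic (Q m b)) as [K|K].
    - destruct (QS m b K) as [c Hc]; exists (upd b m c); split; [|auto].
      intros n L; unfold upd; destruct (Nat.eqb_spec n m); [lia | easy].
    - exists b; split; [easy | contradiction]. }
  assert (Qf : forall m, Q m (f m)).
  { induction m; [now rewrite f0 | now apply Hf]. }
  assert (stable : forall k m n, n < m -> f (k + m) n = f m n).
  { induction k; intros m n L; [easy|]; cbn.
    rewrite (proj1 (Hf (k + m))) by lia; auto. }
  (* Bit [n] of the branch is settled at stage [S n]. The bound [s] met by the limit is refuted by a
     set that shares its first [s] bits. *)
  destruct (H (fun n => f (S n) n)) as [s Hs].
  destruct (Qf s s) as (Z & E & HZ); apply (HZ s (le_n _)).
  rewrite (mask_ext s Z (fun n => f (S n) n)); [exact Hs|].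
  intros n L; rewrite E by exact L.
  rewrite <- (stable (s - S n) (S n) n) by lia; f_equal; lia.
Qed.

(* [u x Z s] is a test reading [Z] below [s]; effectivity in [b] is stated
   through the argument [⟨x, ⟨σ, s⟩⟩], where the bits of [σ] code [Z]. *)
Definition effective (b : nat -> bool) (u : nat -> (nat -> bool) -> nat -> bool) :=
  dec b (fun q => u (π1 q) (mask (π2 (π2 q)) (Nat.testbit (π1 (π2 q)))) (π2 (π2 q))).

(** By compactness some [N] works for all sets at once. Whether a given [N] does is decided from [b]
    by running through the [2 ^ N] codes, so [f x] is found by search. *)
Lemma effective_bound b u :
  effective b u -> (forall x Z, exists s, u x (mask s Z) s = true) ->
  exists f, comp b f /\ forall x Z, exists s, s <= f x /\ u x (mask s Z) s = true.
Proof.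
  intros Hu bar.
  set (P x N := ball (fun σ => bex (fun s => u x (mask s (Nat.testbit σ)) s) (S N)) (2 ^ N)).
  assert (HP : dec b (fun q => P (π1 q) (π2 q))).
  { apply (dec_ball b (fun q σ =>
      bex (fun s => u (π1 q) (mask s (Nat.testbit σ)) s) (S (π2 q))));
      auto using comp_pow2, comp_pi2, comp_id.
    apply (dec_bex b (fun q s =>
      u (π1 (π1 q)) (mask s (Nat.testbit (π2 q))) s));
      auto using comp_S, comp_pi1, comp_pi2, comp_id.
    eapply comp_ext; [|apply (comp_comp b _ (fun q => ⟨π1 (π1 (π1 q)), ⟨π2 (π1 q), π2 q⟩⟩) Hu)];
      [intro; now proj|].
    auto using comp_pair, comp_pi1, comp_pi2, comp_id. }
  destruct (comp_mu b P HP) as (f & Hf & Pf).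
  - intro x; destruct (fan (fun Z s => u x Z s = true) (bar x)) as [N HN].
    exists N; apply ball_spec; intros σ _; apply bex_spec.
    destruct (HN (Nat.testbit σ)) as (s & L & Hs); exists s; split; [lia | exact Hs].
  - exists f; split; [exact Hf|]; intros x Z; specialize (Pf x).
    unfold P in Pf; rewrite ball_spec in Pf.
    destruct (bits_of Z (f x)) as (σ & L & E).
    apply Pf, bex_spec in L as (s & Ls & Hs); exists s; split; [lia|].
    erewrite mask_ext; [exact Hs|]; intros n Ln; rewrite E; unfold mask.
    destruct (Nat.ltb_spec n (f x)); [easy | lia].
Qed.

(** The output has to be below [s] too, so that a bound on the stage also bounds the output. *)
Definition halts (e : code) (O : nat -> bool) (s x : nat) : bool :=
  (0 <? evs e O s x) && (evs e O s x <=? s).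

Lemma halts_elim e O s x :
  halts e O s x = true -> exists y, evs e O s x = S y /\ y < s.
Proof.
  unfold halts; rewrite andb_true_iff, Nat.ltb_lt, Nat.leb_le.
  destruct (evs e O s x) as [|y]; [lia | intros; exists y; lia].
Qed.

Lemma halts_intro e O x y :
  eval (oracle O) e x y -> exists s, forall s', s <= s' -> halts e O s' x = true.
Proof.
  intros [s Hs]%evs_complete; exists (s + S y); intros s' L.
  unfold halts; rewrite (evs_le _ _ _ _ _ _ Hs) by lia.
  rewrite andb_true_iff, Nat.ltb_lt, Nat.leb_le; lia.
Qed.

Lemma dec_halts b e (O : nat -> nat -> bool) s n :
  dec b (fun q => O (π1 q) (π2 q)) -> comp b s -> comp b n ->
  dec b (fun v => halts e (O v) (s v) (n v)).
Proof.
  intros HO Hs Hn; assert (K := comp_evs b e O s n HO Hs Hn).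
  apply dec_and; auto using dec_lt, dec_le, comp_const.
Qed.

Definition dominated (a b : nat -> bool) : Prop :=
  forall f, comp a f -> exists g, comp b g /\ forall x, f x <= g x.

(** A decoding obtained by choice; it serves to enumerate the programs in the stagewise
    constructions. *)
Lemma encode_surjection : exists d : nat -> code, forall e, d (encode e) = e.
Proof.
  destruct (functional_choice (fun n e => forall e', encode e' = n -> e' = e))
    as [d Hd].
  - intro n; destruct (classic (exists e, encode e = n)) as [[e He]|N].
    + exists e; intros e' He'; apply encode_inj; congruence.
    + exists cZero; intros e' He'; destruct N; eauto.
  - exists d; intro e; symmetry; now apply Hd.
Qed.

Lemma dec_mask b f s n :
  comp b f -> comp b s -> comp b n ->
  dec b (fun q => mask (s q) (Nat.testbit (f q)) (n q)).
Proof. intros; apply dec_and; auto using dec_lt, dec_testbit. Qed.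

(* The hyperimmune-free basis theorem relative to [b]: a nonempty Π⁰₁ class, the
   sets [Z] never rejected by the test [u], has a member whose computable
   functions are dominated by [b]-computable ones. *)
Lemma hyperimmune_free_basis b (u : (nat -> bool) -> nat -> bool) Z0 :
  effective b (fun _ => u) -> (forall s, u (mask s Z0) s = false) ->
  exists Z, dominated Z b /\ forall s, u (mask s Z) s = false.
Proof.
  intros Hu HZ0.
  (* The forcing conditions: tests that describe nonempty Π⁰₁ classes relative to [b]. *)
  set (T := {w : (nat -> bool) -> nat -> bool |
    effective b (fun _ => w) /\ exists Z, forall s, w (mask s Z) s = false}).
  set (member (w : T) Z := forall s, proj1_sig w (mask s Z) s = false).
  destruct encode_surjection as [d Hd].
  (* Stage [n] treats the program [d n]. Either, for each [x], every set gets rejected or makes it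
     converge, which compactness turns into a bound; or it diverges at one [x] throughout the new
     class. *)
  destruct (dependent_choice (fun n (w w' : T) =>
    (forall Z, member w' Z -> member w Z) /\
    ((forall x Z, exists s, proj1_sig w (mask s Z) s || halts (d n) (mask s Z) s x = true) \/
     (exists x, forall Z, member w' Z -> forall s, halts (d n) Z s x = false)))
    (exist _ u (conj Hu (ex_intro _ Z0 HZ0)))) as (w & w0 & Hw).
  { intros n w.
    destruct (classic (forall x Z, exists s,
      proj1_sig w (mask s Z) s || halts (d n) (mask s Z) s x = true)) as [K|K];
      [exists w; auto|].
    (* This [Z] shows that adding divergence at [x] to the test leaves the class nonempty. *)
    apply not_all_ex_not in K as [x K]; apply not_all_ex_not in K as [Z K].
    destruct w as [w [Ew ?]]; cbn [proj1_sig] in *.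
    assert (Ew' : effective b (fun _ Z s => w Z s || halts (d n) Z s x)).
    { apply dec_or; [exact Ew|].
      apply (dec_halts b (d n) (fun q => mask (π2 (π2 q)) (Nat.testbit (π1 (π2 q)))));
        auto using comp_const, comp_pi2, comp_id.
      apply (dec_mask b (fun q => π1 (π2 (π1 q)))  (fun q => π2 (π2 (π1 q))) (fun q => π2 q));
      auto using comp_pi1, comp_pi2, comp_id. }
    exists (exist _ (fun Z s => w Z s || halts (d n) Z s x) (conj Ew' (ex_intro _ Z
      (fun s => not_true_is_false _ (fun E => K (ex_intro _ s E)))))).
    unfold member; cbn [proj1_sig]; split; [|right; exists x].
    - intros Z' H s; now destruct (orb_false_elim _ _ (H s)).
    - intros Z' H s; destruct (orb_false_elim _ _ (H s)) as [_ E].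
      unfold halts in *; now rewrite evs_mask in E. }
  assert (down : forall k n Z, member (w (k + n)) Z -> member (w n) Z).
  { induction k; intros n Z H; [exact H | now apply IHk, Hw]. }
  destruct (classic (exists Z, forall n, member (w n) Z)) as [[Z HZ]|E].
  - exists Z; split; [|specialize (HZ 0); now rewrite w0 in HZ].
    intros f [e He].
    destruct (proj2 (Hw (encode e))) as [K|[x K]]; rewrite Hd in K.
    + apply (effective_bound b (fun x Z s =>
        proj1_sig (w (encode e)) Z s || halts e Z s x)) in K as (g & Hg & K).
      * exists g; split; [exact Hg|]; intro x.
        destruct (K x Z) as (s & L & Hs); rewrite (HZ (encode e) s) in Hs; cbn in Hs.
        unfold halts in Hs; rewrite evs_mask in Hs.
        apply halts_elim in Hs as (y & Hs & Ly).
        apply evs_sound, (eval_oracle_functional _ _ _ _ _ (He x)) in Hs; lia.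
      * apply dec_or; [apply (proj2_sig (w (encode e)))|].
        apply (dec_halts b e (fun q => mask (π2 (π2 q)) (Nat.testbit (π1 (π2 q)))));
          auto using comp_pi1, comp_pi2, comp_id.
        apply (dec_mask b (fun q => π1 (π2 (π1 q)))  (fun q => π2 (π2 (π1 q))) (fun q => π2 q));
        auto using comp_pi1, comp_pi2, comp_id.
    + destruct (halts_intro _ _ _ _ (He x)) as [s Hs].
      specialize (K Z (HZ _) s); now rewrite Hs in K.
  - exfalso.
    (* If no set lay in all the classes, compactness would give an [N] such that every set is
       rejected by a test of index at most [N]; but the class of [w N] is nonempty and contained in
       the earlier ones. *)
    destruct (fan (fun Z t => exists n s, n <= t /\ s <= t /\
      proj1_sig (w n) (mask s Z) s = true)) as [N HN].
    + intro Z; apply NNPP; intro K; apply E; exists Z; intros n s.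
      apply not_true_is_false; intro F; apply K.
      exists (n + s), n, s; split; [lia|]; split; [lia|].
      rewrite (mask_ext s _ Z); [exact F|].
      intros m L; unfold mask; destruct (Nat.ltb_spec m (n + s)); [easy | lia].
    + destruct (proj2_sig (w N)) as [_ [Z HZ]].
      destruct (HN Z) as (t & Lt & n & s & Ln & Ls & F).
      rewrite (mask_ext s _ Z) in F
        by (intros m L; unfold mask; destruct (Nat.ltb_spec m t); [easy | lia]).
      assert (M : member (w n) Z).
      { apply (down (N - n)); replace (N - n + n) with N by lia; exact HZ. }
      now rewrite (M s) in F.
Qed.

(** * The 0'-computable colouring *)

Lemma char_empty : char (fun _ => False) = oracle (fun _ => false).
Proof.
  unfold oracle; f_equal; extensionality n.
  apply propositional_extensionality; easy.
Qed.

(** The predicate searched ignores the search variable, so the search stops at [0] or never. *)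
Lemma equality_test : exists t, forall x,
  (exists y, eval (oracle (fun _ => false)) t x y) <-> π1 x = π2 x.
Proof.
  destruct (dec_neg (fun _ => false) (fun q => π1 (π1 q) =? π2 (π1 q))) as [e He];
    [apply dec_eq; auto using comp_pi1, comp_pi2, comp_id|].
  exists (cMu e); intro x; split.
  - intros (y & [H _]); specialize (He ⟨x, y⟩); proj.
    destruct (Nat.eqb_spec (π1 x) (π2 x)); [easy|].
    discriminate (eval_oracle_functional _ _ _ _ _ H He).
  - intro E; exists 0; split; [|lia].
    specialize (He ⟨x, 0⟩); proj; now rewrite E, Nat.eqb_refl in He.
Qed.

(* On input [n] the value of the program number [m], if any, is found by asking
   [0'] whether the program sending [⟨n, y⟩] to "halt iff [m] outputs [y] on [n]"
   halts, for successive [y]. *)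
Lemma halting_dominates_computable :
  exists b g, char halting_problem = oracle b /\ comp b g /\
    forall f, comp (fun _ => false) f -> exists N, forall n, N <= n -> f n <= g n.
Proof.
  destruct (char_bool halting_problem) as (b & Eb & Hb).
  destruct equality_test as [t Ht].
  set (test e := cComp t (cPair (cComp e cFst) cSnd)).
  assert (Htest : forall e n y, (exists z, eval (oracle (fun _ => false)) (test e) ⟨n, y⟩ z) <->
    eval (oracle (fun _ => false)) e n y).
  { intros e n y; cbn [eval test]; proj; split.
    - intros (z & w & (u & v & (n' & -> & Hu) & -> & ->) & Hz).
      proj; assert (E : u = y) by (specialize (Ht ⟨u, y⟩); proj; apply Ht; eauto).
      now subst.
    - intro H; destruct (proj2 (Ht ⟨y, y⟩)) as [z Hz]; [now proj|].
      exists z, ⟨y, y⟩; split; [|exact Hz]; exists y, y.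
      split; [exists n; auto | auto]. }
  (* [num (encode e)] is [encode (test e)], written as a computable function of the number
     [encode e]. *)
  set (num m := ⟨6, ⟨encode t, ⟨5, ⟨⟨6, ⟨m, encode cFst⟩⟩, encode cSnd⟩⟩⟩⟩).
  assert (halt : forall e n, b ⟨encode e, n⟩ = true <->
    exists y, eval (oracle (fun _ => false)) e n y).
  { intros e n; rewrite <- Hb; unfold halting_problem; rewrite char_empty; split.
    - intros (e' & x & E & H); apply Cantor.to_nat_inj, pair_equal_spec in E as [E ->].
      now apply encode_inj in E as ->.
    - intro H; exists e, n; auto. }
  (* When [v] is outside the halting problem every [y] is accepted, so that the search always
     ends. *)
  set (P v y := negb (b v) || b ⟨num (π1 v), ⟨π2 v, y⟩⟩).
  destruct (comp_mu b P) as (val & Hval & Pval).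
  - apply dec_or.
    + apply dec_neg, comp_oracle, comp_fst.
    + apply comp_oracle; unfold num.
      auto 20 using comp_pair, comp_const, comp_pi1, comp_pi2, comp_id.
  - intro v; unfold P; destruct (b v) eqn:E; [|now exists 0].
    assert (K := proj2 (Hb v) E); destruct K as (e & n & -> & y & Hy).
    rewrite char_empty in Hy; exists y; cbn [negb orb]; proj.
    apply (halt (test e)), Htest, Hy.
  (* The sum runs over the programs numbered below [n], hence bounds a computable function beyond
     the number of its program. *)
  - exists b, (fun n => nat_rect (fun _ => nat) 0 (fun m r => r + val ⟨m, n⟩) n).
    split; [exact Eb|]; split.
    + apply (comp_rec b (fun _ => 0) (fun n m r => r + val ⟨m, n⟩));
        auto using comp_const, comp_id.
      apply comp_add; [auto using comp_pi2, comp_id|].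
      apply (comp_comp b val); auto using comp_pair, comp_pi1, comp_pi2, comp_id.
    + intros f [e He]; exists (S (encode e)); intros n L.
      assert (V : f n = val ⟨encode e, n⟩).
      { specialize (Pval ⟨encode e, n⟩); unfold P in Pval; proj.
        rewrite (proj2 (halt e n)) in Pval by eauto; cbn [negb orb] in Pval.
        apply (halt (test e)), Htest in Pval.
        exact (eval_oracle_functional _ _ _ _ _ (He n) Pval). }
      rewrite V.
      enough (H : forall k, encode e < k -> val ⟨encode e, n⟩ <=
        nat_rect (fun _ => nat) 0 (fun m r => r + val ⟨m, n⟩) k) by auto.
      induction k as [|k IH]; [lia|]; intro Lk; cbn.
      destruct (Nat.eq_dec (encode e) k) as [<-|]; [|specialize (IH ltac:(lia))]; lia.
Qed.

(* The state [⟨l, j⟩] records the last point and the colour of the current block. *)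
Lemma block_coloring b g k :
  comp b g -> 1 <= k ->
  exists c, comp b c /\ (forall n, 1 <= c n <= k) /\
    forall j N, 1 <= j <= k ->
      exists x, N <= x /\ forall y, x <= y <= x + g x -> c y = j.
Proof.
  intros Hg Hk.
  set (next j := if j =? k then 1 else S j).
  (* The first block is [[0, g 0]], of colour 1; a new block opens just after the end of the current
     one. *)
  set (st n := nat_rect (fun _ => nat) ⟨g 0, 1⟩ (fun m r =>
    if S m <=? π1 r then r else ⟨S m + g (S m), next (π2 r)⟩) n).
  assert (stS : forall n, st (S n) =
    if S n <=? π1 (st n) then st n else ⟨S n + g (S n), next (π2 (st n))⟩) by reflexivity.
  assert (range : forall n, 1 <= π2 (st n) <= k).
  { induction n as [|n IH]; [cbn; proj; lia|]; rewrite stS.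
    destruct (S n <=? _); [exact IH|]; proj; unfold next.
    destruct (Nat.eqb_spec (π2 (st n)) k); lia. }
  assert (block : forall x j, st x = ⟨x + g x, j⟩ ->
    forall y, x <= y <= x + g x -> st y = ⟨x + g x, j⟩).
  { intros x j E y [L L']; induction L as [|y L IH]; [exact E|].
    rewrite stS, IH by lia; proj.
    destruct (Nat.leb_spec (S y) (x + g x)); [easy | lia]. }
  assert (step : forall x j, st x = ⟨x + g x, j⟩ ->
    exists x', x < x' /\ st x' = ⟨x' + g x', next j⟩).
  { intros x j E; exists (S (x + g x)); split; [lia|].
    rewrite stS, (block x j E) by lia; proj.
    destruct (Nat.leb_spec (S (x + g x)) (x + g x)); [lia | easy]. }
  assert (up : forall t x j, j + t <= k -> st x = ⟨x + g x, j⟩ ->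
    exists x', x <= x' /\ st x' = ⟨x' + g x', j + t⟩).
  { induction t as [|t IH]; intros x j L E; [exists x; rewrite Nat.add_0_r; auto|].
    destruct (step x j E) as (x1 & L1 & E1); unfold next in E1.
    destruct (Nat.eqb_spec j k); [lia|].
    destruct (IH x1 (S j)) as (x2 & L2 & E2); [lia | exact E1|].
    exists x2; rewrite E2; split; [|f_equal; f_equal]; lia. }
  (* From a block of colour 1, [k - 1] further blocks lead to colour [k], and the next one begins a
     new cycle. *)
  assert (ones : forall N, exists x, N <= x /\ st x = ⟨x + g x, 1⟩).
  { induction N as [|N (x & L & E)]; [exists 0; auto|].
    destruct (up (k - 1) x 1) as (x1 & L1 & E1); [lia | exact E|].
    destruct (step x1 _ E1) as (x2 & L2 & E2); exists x2; split; [lia|].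
    rewrite E2; unfold next; destruct (Nat.eqb_spec (1 + (k - 1)) k); [easy | lia]. }
  exists (fun n => π2 (st n)); split; [|split; [exact range|]].
  - apply comp_pi2, (comp_rec b (fun _ => ⟨g 0, 1⟩) (fun _ m r =>
      if S m <=? π1 r then r else ⟨S m + g (S m), next (π2 r)⟩));
      auto using comp_const, comp_id.
    apply comp_if; auto 8 using dec_le, comp_S, comp_pi1, comp_pi2, comp_id.
    apply comp_pair.
    + apply comp_add; [|apply (comp_comp b g)]; auto using comp_S, comp_pi1, comp_pi2, comp_id.
    + apply comp_if; auto using dec_eq, comp_const, comp_S, comp_pi2, comp_id.
  - intros j N Hj; destruct (ones N) as (x & L & E).
    destruct (up (j - 1) x 1) as (x1 & L1 & E1); [lia | exact E|].
    exists x1; split; [lia|]; intros y Hy.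
    rewrite (block x1 _ E1 y Hy); proj; lia.
Qed.

(** Blocks of colour [j] start arbitrarily late, so one starts at an [x] where [f x <= g x]; it
    covers [[x, f x]]. *)
Lemma escaping_coloring k : 1 <= k ->
  exists c, computable_in halting_problem (fun x y => c x = y) /\
    (forall n, 1 <= c n <= k) /\
    forall f j, comp (fun _ => false) f -> 1 <= j <= k ->
      exists x, forall y, x <= y <= f x -> c y = j.
Proof.
  intro Hk.
  destruct halting_dominates_computable as (b & g & Eb & Hg & Dg).
  destruct (block_coloring b g k Hg Hk) as (c & [e He] & range & blocks).
  exists c; split; [|split; [exact range|]].
  - exists e; rewrite Eb; intros x y; split; [|now intros <-].
    apply eval_oracle_functional, He.
  - intros f j Hf Hj; destruct (Dg f Hf) as [N HN].
    destruct (blocks j N Hj) as (x & L & H); exists x; intros y Hy.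
    apply H; specialize (HN x L); lia.
Qed.

(** * Forcing *)

Lemma list_bound (h : nat -> nat) l : exists N, forall i, In i l -> h i < N.
Proof.
  induction l as [|a l [N HN]]; [exists 0; easy|].
  exists (S (h a) + N); intros i [->|Hi]; [|specialize (HN i Hi)]; lia.
Qed.

Definition unbounded (X : nat -> bool) : Prop :=
  forall n, exists x, n <= x /\ X x = true.

(** Infinite pigeonhole: if all the finitely many sets were bounded, they would have a common
    bound. *)
Lemma unbounded_cover X S (P : nat -> nat -> bool) :
  unbounded X -> (forall x, X x = true -> exists i, In i S /\ P i x = true) ->
  exists i, In i S /\ unbounded (P i).
Proof.
  intros HX cover; apply NNPP; intro N.
  assert (B : forall i, exists n, In i S -> forall x, n <= x -> P i x = false).
  { intro i; apply NNPP; intro F; apply N; exists i.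
    split; [apply NNPP; intro K; apply F; exists 0; contradiction|].
    intro n; apply NNPP; intro K; apply F; exists n; intros _ x L.
    apply not_true_is_false; eauto. }
  destruct (functional_choice _ B) as [h Hh]; destruct (list_bound h S) as [m Hm].
  destruct (HX m) as (x & L & Hx); destruct (cover x Hx) as (i & Hi & HP).
  specialize (Hm i Hi); rewrite (Hh i Hi) in HP; [discriminate | lia].
Qed.

Definition hyperimmune_free (X : nat -> bool) : Prop :=
  dominated X (fun _ => false).

Lemma dominated_trans a b c : dominated a b -> dominated b c -> dominated a c.
Proof.
  intros H K f (g & Hg & L)%H; destruct (K g Hg) as (h & Hh & L').
  exists h; split; [exact Hh|]; intro x; specialize (L x); specialize (L' x); lia.
Qed.

Lemma dominated_dec a b : dec b a -> dominated a b.
Proof. intros H f Hf; exists f; split; [exact (comp_trans a b f Hf H) | auto]. Qed.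

(** Cutting a reservoir protects the finite part of an oracle that a computation has read. *)
Definition cut (n : nat) (X : nat -> bool) (x : nat) : bool := (n <=? x) && X x.

Lemma cut_spec n X x : cut n X x = true <-> n <= x /\ X x = true.
Proof. unfold cut; now rewrite andb_true_iff, Nat.leb_le. Qed.

Lemma cut_hyperimmune_free n X : hyperimmune_free X -> hyperimmune_free (cut n X).
Proof.
  apply dominated_trans, dominated_dec, dec_and.
  - apply (dec_le X (fun _ => n)); auto using comp_const, comp_id.
  - apply (comp_oracle X (fun x => x)), comp_id.
Qed.

Lemma cut_unbounded n X : unbounded X -> unbounded (cut n X).
Proof.
  intros H m; destruct (H (n + m)) as (x & L & Hx); exists x.
  rewrite cut_spec; repeat split; [lia | lia | exact Hx].
Qed.

(* With [S] of minimal size, no further thinning of the reservoir can exclude a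
   colour of [S]. *)
Lemma minimal_reservoir (J : nat -> nat) r : (forall x, 1 <= J x <= r) ->
  exists S X, length S <= r /\ hyperimmune_free X /\ unbounded X /\
    (forall x, X x = true -> In (J x) S) /\
    forall Y, hyperimmune_free Y -> unbounded Y -> (forall x, Y x = true -> X x = true) ->
      forall i, In i S -> forall n, exists x, n <= x /\ Y x = true /\ J x = i.
Proof.
  intro HJ.
  enough (H : forall m S X, length S = m -> m <= r -> hyperimmune_free X -> unbounded X ->
    (forall x, X x = true -> In (J x) S) ->
    exists S X, length S <= r /\ hyperimmune_free X /\ unbounded X /\
    (forall x, X x = true -> In (J x) S) /\
    forall Y, hyperimmune_free Y -> unbounded Y -> (forall x, Y x = true -> X x = true) ->
      forall i, In i S -> forall n, exists x, n <= x /\ Y x = true /\ J x = i).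
  { apply (H r (seq 1 r) (fun _ => true)).
    - apply length_seq.
    - easy.
    - apply dominated_dec, dec_const.
    - intro n; exists n; auto.
    - intros x _; apply in_seq; specialize (HJ x); lia. }
  induction m as [m IH] using lt_wf_ind; intros S X Em Lm FX UX CX.
  apply NNPP; intro N; apply N; exists S, X; rewrite Em; repeat (split; [assumption|]).
  (* If [Y] misses the colour [i] from [n] on, [i] is dropped from [S] and [cut n Y] becomes the
     reservoir. *)
  intros Y FY UY SY i Hi n; apply NNPP; intro K; apply N.
  assert (L := remove_length_lt Nat.eq_dec S i Hi); rewrite Em in L.
  apply (IH _ L (remove Nat.eq_dec i S) (cut n Y));
    auto using cut_hyperimmune_free, cut_unbounded; [lia|].
  intros x [Lx Hx]%cut_spec; apply in_in_remove; [|auto].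
  intro E; apply K; eauto.
Qed.

Lemma testbit_high E s n : E < 2 ^ s -> s <= n -> Nat.testbit E n = false.
Proof.
  intros L L'; rewrite <- (Nat.mod_small E (2 ^ s)) by exact L.
  now apply Nat.mod_pow2_bits_high.
Qed.

(** * The test attached to one requirement *)

Section Requirement.

Context (S : list nat) (X : nat -> bool) (F : nat -> nat) (e : nat -> code).

(* [Z] codes the sets [{n | Z ⟨i, n⟩}], [i] in [S]; the first disjunct says that
   their union is visibly not [X], the second that one of them visibly contains a
   finite [E] for which [e i] halts on [x] with oracle [E ∪ F i]. *)
Definition cover_test (x : nat) (Z : nat -> bool) (s : nat) : bool :=
  bex (fun n =>
    X n && forallb (fun i => (⟨i, n⟩ <? s) && negb (Z ⟨i, n⟩)) S ||
    negb (X n) && existsb (fun i => Z ⟨i, n⟩) S) s ||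
  existsb (fun i => bex (fun E =>
    ball (fun n => negb (Nat.testbit E n) || Z ⟨i, n⟩) s &&
    halts (e i) (fun n => Nat.testbit E n || Nat.testbit (F i) n) s x) (2 ^ s)) S.

(** For [i] in the finite list [S], the number [F i] and the program [e i] enter as constants; the
    oracle answers only membership in [X]. *)
Lemma cover_test_effective : effective X cover_test.
Proof.
  assert (Hmask : forall f s i n, comp X f -> comp X s -> comp X n ->
    dec X (fun q => mask (s q) (Nat.testbit (f q)) ⟨i, n q⟩)).
  { intros f s i n Hf Hs Hn.
    apply (dec_mask X f s (fun q => ⟨i, n q⟩)); auto using comp_pair, comp_const. }
  apply dec_or.
  - apply (dec_bex X (fun q n =>
      X n && forallb (fun i => (⟨i, n⟩ <? π2 (π2 q)) &&
        negb (mask (π2 (π2 q)) (Nat.testbit (π1 (π2 q))) ⟨i, n⟩)) S ||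
      negb (X n) && existsb (fun i =>
        mask (π2 (π2 q)) (Nat.testbit (π1 (π2 q))) ⟨i, n⟩) S));
      [|auto using comp_pi2, comp_id].
    apply dec_or; apply dec_and.
    + apply comp_oracle, comp_snd.
    + apply (dec_forallb X (fun i q => (⟨i, π2 q⟩ <? π2 (π2 (π1 q))) &&
        negb (mask (π2 (π2 (π1 q))) (Nat.testbit (π1 (π2 (π1 q)))) ⟨i, π2 q⟩))).
      intro i; apply dec_and.
      * apply dec_lt; auto using comp_pair, comp_const, comp_pi1, comp_pi2, comp_id.
      * apply dec_neg, (Hmask (fun q => π1 (π2 (π1 q))) (fun q => π2 (π2 (π1 q))));
          auto using comp_pi1, comp_pi2, comp_id.
    + apply dec_neg, comp_oracle, comp_snd.
    + apply (dec_existsb X (fun i q =>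
        mask (π2 (π2 (π1 q))) (Nat.testbit (π1 (π2 (π1 q)))) ⟨i, π2 q⟩)).
      intro i; apply (Hmask (fun q => π1 (π2 (π1 q))) (fun q => π2 (π2 (π1 q))));
        auto using comp_pi1, comp_pi2, comp_id.
  - apply (dec_existsb X (fun i q => bex (fun E =>
      ball (fun n => negb (Nat.testbit E n) ||
        mask (π2 (π2 q)) (Nat.testbit (π1 (π2 q))) ⟨i, n⟩) (π2 (π2 q)) &&
      halts (e i) (fun n => Nat.testbit E n || Nat.testbit (F i) n) (π2 (π2 q)) (π1 q))
      (2 ^ π2 (π2 q)))).
    intro i; apply (dec_bex X (fun q E =>
      ball (fun n => negb (Nat.testbit E n) ||
        mask (π2 (π2 q)) (Nat.testbit (π1 (π2 q))) ⟨i, n⟩) (π2 (π2 q)) &&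
      halts (e i) (fun n => Nat.testbit E n || Nat.testbit (F i) n) (π2 (π2 q)) (π1 q)));
      [|auto using comp_pow2, comp_pi2, comp_id].
    apply dec_and.
    + apply (dec_ball X (fun q n => negb (Nat.testbit (π2 q) n) ||
        mask (π2 (π2 (π1 q))) (Nat.testbit (π1 (π2 (π1 q)))) ⟨i, n⟩));
        [|auto using comp_pi1, comp_pi2, comp_id].
      apply dec_or; [apply dec_neg, dec_testbit|
        apply (Hmask (fun q => π1 (π2 (π1 (π1 q)))) (fun q => π2 (π2 (π1 (π1 q)))))];
        auto 8 using comp_pi1, comp_pi2, comp_id.
    + apply (dec_halts X (e i) (fun q n => Nat.testbit (π2 q) n || Nat.testbit (F i) n));
        [apply dec_or; apply dec_testbit| |];
        auto using comp_const, comp_pi1, comp_pi2, comp_id.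
Qed.

(** A true cover of [X] never triggers the first disjunct, so the second holds; the bits of a number
    below [2 ^ s] are all below [s]. *)
Lemma cover_test_true x Z s :
  (forall n, X n = true <-> exists i, In i S /\ Z ⟨i, n⟩ = true) ->
  cover_test x (mask s Z) s = true ->
  exists i E y, In i S /\ (forall n, Nat.testbit E n = true -> n < s /\ Z ⟨i, n⟩ = true) /\
    evs (e i) (fun n => Nat.testbit E n || Nat.testbit (F i) n) s x = Datatypes.S y /\ y < s.
Proof.
  intro cover; unfold cover_test; rewrite orb_true_iff, bex_spec, existsb_exists.
  intros [(n & Ln & [H|H]%orb_prop)|(i & Hi & H)].
  - exfalso; apply andb_prop in H as [HX H].
    apply cover in HX as (i & Hi & HZ).
    apply (proj1 (forallb_forall _ _) H), andb_prop in Hi as [Hlt Hi].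
    unfold mask in Hi; now rewrite Hlt, HZ in Hi.
  - exfalso; apply andb_prop in H as [HX H].
    apply existsb_exists in H as (i & Hi & H).
    apply andb_prop in H as [_ HZ]; rewrite (proj2 (cover n)) in HX by eauto; easy.
  - apply bex_spec in H as (E & LE & [H1 H2]%andb_prop).
    apply halts_elim in H2 as (y & Hy & Ly); exists i, E, y; repeat split; auto.
    + apply not_ge; intro L; now rewrite (testbit_high E s) in H.
    + rewrite ball_spec in H1.
      assert (L : n < s) by (apply not_ge; intro L; now rewrite (testbit_high E s) in H).
      specialize (H1 n L); rewrite H in H1.
      now apply andb_prop in H1.
Qed.

(** At a large enough stage a failure to cover [X] would be visible, and a convergent computation
    would use finitely many elements of [G], which the test would have found. *)
Lemma cover_test_false x Z :
  (forall s, cover_test x (mask s Z) s = false) ->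
  (forall n, X n = true <-> exists i, In i S /\ Z ⟨i, n⟩ = true) /\
  forall i (G : nat -> bool), In i S ->
    (forall n, Nat.testbit (F i) n = true -> G n = true) ->
    (forall n, G n = true -> Nat.testbit (F i) n = true \/ Z ⟨i, n⟩ = true) ->
    forall y, ~ eval (oracle G) (e i) x y.
Proof.
  intro H; split.
  - intro n; destruct (list_bound (fun i => ⟨i, n⟩) S) as [N HN].
    (* Large enough for the test to see [n] and all the bits [Z ⟨i, n⟩] with [i] in [S]. *)
    set (s := Datatypes.S n + N).
    assert (M : forall i, In i S -> mask s Z ⟨i, n⟩ = Z ⟨i, n⟩ /\ (⟨i, n⟩ <? s) = true).
    { intros i Hi; specialize (HN i Hi); unfold mask.
      assert (L : (⟨i, n⟩ <? s) = true) by (apply Nat.ltb_lt; unfold s; lia).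
      now rewrite L. }
    specialize (H s); apply orb_false_elim in H as [H _].
    apply not_true_iff_false in H; rewrite bex_spec in H.
    split; intro K; apply NNPP; intro K'; apply H; exists n; (split; [unfold s; lia|]).
    + rewrite K; apply orb_true_intro; left; apply forallb_forall; intros i Hi.
      destruct (M i Hi) as [-> ->]; destruct (Z ⟨i, n⟩) eqn:E; [|easy].
      exfalso; eauto.
    + apply orb_true_intro; right; apply not_true_is_false in K'; rewrite K'.
      destruct K as (i & Hi & HZ); apply existsb_exists; exists i; split; [exact Hi|].
      now rewrite (proj1 (M i Hi)).
  - intros i G Hi FG GF y Hy.
    apply evs_complete in Hy as [s Hs].
    (* [E] is the part below [s] of [G] lying in the [i]-th set of the cover; the other elements of
       [G] belong to [F i]. *)
    destruct (bits_of (fun n => G n && Z ⟨i, n⟩) s) as (E & LE & HE).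
    destruct (list_bound (fun n => ⟨i, n⟩) (seq 0 s)) as [N HN].
    (* Above the number of steps, the codes [⟨i, n⟩] for [n < s], and the output. *)
    set (t := s + N + Datatypes.S y).
    assert (Ht : evs (e i) (fun n => Nat.testbit E n || Nat.testbit (F i) n) t x
      = Datatypes.S y).
    { apply (evs_mono _ G _ s t); [unfold t; lia | | exact Hs].
      intros n L; rewrite HE; unfold mask; rewrite (proj2 (Nat.ltb_lt n s) L); cbn.
      destruct (G n) eqn:EG, (Z ⟨i, n⟩) eqn:EZ, (Nat.testbit (F i) n) eqn:EF; try easy.
      all: try (apply FG in EF; congruence).
      destruct (GF n EG); congruence. }
    specialize (H t); apply orb_false_elim in H as [_ H].
    apply not_true_iff_false in H; apply H, existsb_exists; exists i; split; [exact Hi|].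
    apply bex_spec; exists E; split.
    + apply (Nat.lt_le_trans _ _ _ LE), Nat.pow_le_mono_r; unfold t; lia.
    + apply andb_true_intro; split.
      * apply ball_spec; intros n _; rewrite HE; unfold mask at 1.
        destruct (Nat.ltb_spec n s) as [L|]; [cbn [andb]|easy].
        assert (B : ⟨i, n⟩ < N) by (apply HN, in_seq; lia).
        unfold mask; rewrite (proj2 (Nat.ltb_lt ⟨i, n⟩ t)) by (unfold t; lia).
        now destruct (G n), (Z ⟨i, n⟩).
      * unfold halts; rewrite Ht, andb_true_iff, Nat.ltb_lt, Nat.leb_le; unfold t; lia.
Qed.

End Requirement.

(** * Mathias conditions with a common reservoir, and their generic sets *)

Definition condition (J : nat -> nat) (F : nat -> nat) (X : nat -> bool) : Prop :=
  hyperimmune_free X /\ unbounded X /\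
  forall i x, Nat.testbit (F i) x = true -> J x = i.

Definition extends (F' : nat -> nat) (X' : nat -> bool) (F : nat -> nat) (X : nat -> bool) :=
  (forall x, X' x = true -> X x = true) /\
  forall i x, (Nat.testbit (F i) x = true -> Nat.testbit (F' i) x = true) /\
    (Nat.testbit (F' i) x = true -> Nat.testbit (F i) x = true \/ X x = true).

Definition between (F : nat -> nat) (X : nat -> bool) (G : nat -> nat -> bool) :=
  forall i x, (Nat.testbit (F i) x = true -> G i x = true) /\
    (G i x = true -> Nat.testbit (F i) x = true \/ X x = true).

(** The property denied is the one that a computed solution of a colour other than [j] provides for
    some program. *)
Definition avoids (c : nat -> nat) (j : nat) (e : code) (G : nat -> bool) : Prop :=
  ~ forall x, exists y, x <= y /\ eval (oracle G) e x y /\ c y <> j.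

Lemma requirement_step c j J S F X (e : nat -> code) :
  (forall f, comp (fun _ => false) f -> exists x, forall y, x <= y <= f x -> c y = j) ->
  condition J F X -> (forall x, X x = true -> In (J x) S) ->
  exists F' X', condition J F' X' /\ extends F' X' F X /\
    forall G, between F' X' G -> exists i, In i S /\ avoids c j (e i) (G i).
Proof.
  intros escape (FX & UX & CF) CX.
  destruct (classic (forall x Z, exists s, cover_test S X F e x (mask s Z) s = true))
    as [K|K].
  - destruct (effective_bound X _ (cover_test_effective S X F e) K) as (f & Hf & K').
    destruct (FX f Hf) as (g & Hg & Lg); destruct (escape g Hg) as [x Hx].
    (* The cover of [X] by the colour classes of [J]: the set [E] found inside it may be added to
       [F i]. *)
    destruct (K' x (fun m => X (π2 m) && (J (π2 m) =? π1 m))) as (s & Ls & Hs).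
    apply cover_test_true in Hs as (i & E & y & Hi & HE & Hy & Ly).
    2: { intro n; split.
      - intro H; exists (J n); proj; rewrite H, Nat.eqb_refl; auto.
      - intros (i & _ & H); proj; now apply andb_prop in H. }
    (* Cutting at [s] freezes [G i] below [s], where it agrees with the union of [E] and [F i]. *)
    exists (fun i' => if i' =? i then Nat.lor (F i) E else F i'), (cut s X).
    split; [|split; [split|]].
    + split; [now apply cut_hyperimmune_free|]; split; [now apply cut_unbounded|].
      intros i' n; destruct (Nat.eqb_spec i' i) as [->|]; [|apply CF].
      rewrite Nat.lor_spec, orb_true_iff; intros [H|H]; [now apply CF|].
      apply HE in H as [_ H]; proj; apply andb_prop in H as [_ H]; now apply Nat.eqb_eq.
    + intros n H; now apply cut_spec in H.
    + intros i' n; destruct (Nat.eqb_spec i' i) as [->|]; [|auto].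
      rewrite Nat.lor_spec, orb_true_iff; split; [auto|intros [H|H]; [auto|]].
      apply HE in H as [_ H]; proj; apply andb_prop in H as [H _]; auto.
    + intros G HG; exists i; split; [exact Hi|]; intro H.
      destruct (H x) as (y' & L & Hy' & N); apply N, Hx.
      assert (Ey : eval (oracle (G i)) (e i) x y).
      { apply (evs_sound _ _ s).
        apply (evs_mono _ _ (G i) s s) in Hy; [exact Hy | easy |].
        intros n Ln; destruct (HG i n) as [A B]; rewrite Nat.eqb_refl, Nat.lor_spec in *.
        rewrite orb_comm in A, B; rewrite cut_spec in B.
        destruct (Nat.testbit E n || Nat.testbit (F i) n);
          [symmetry; auto | destruct (G i n); [|easy]].
        destruct B; [easy | easy | lia]. }
      (* The output satisfies [y < s <= f x <= g x], so if [x <= y] it lies in the interval of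
         colour [j]. *)
      rewrite (eval_oracle_functional _ _ _ _ _ Hy' Ey) in *.
      specialize (Lg x); lia.
  - apply not_all_ex_not in K as [x K]; apply not_all_ex_not in K as [Z0 K].
    destruct (hyperimmune_free_basis X (cover_test S X F e x) Z0) as (Z & DZ & HZ).
    + eapply comp_ext; [|apply (comp_comp X _ (fun q => ⟨x, π2 q⟩)
        (cover_test_effective S X F e))]; [intro; now proj|].
      auto using comp_pair, comp_const, comp_snd.
    + intro s; apply not_true_is_false; eauto.
    + apply cover_test_false in HZ as [cover diverge].
      destruct (unbounded_cover X S (fun i n => Z ⟨i, n⟩) UX (fun n => proj1 (cover n)))
        as (i & Hi & UZ).
      (* Only the reservoir changes: it shrinks to an infinite set of the cover, so [e i] diverges
         on [x] for every [G i] still allowed. *)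
      exists F, (fun n => Z ⟨i, n⟩); split; [|split; [split|]].
      * split; [|auto].
        apply (dominated_trans _ Z), (dominated_trans _ X); auto.
        apply dominated_dec, (comp_oracle Z (fun n => ⟨i, n⟩)).
        auto using comp_pair, comp_const, comp_id.
      * intros n H; apply cover; eauto.
      * auto.
      * intros G HG; exists i; split; [exact Hi|]; intro H.
        destruct (H x) as (y & _ & Hy & _).
        apply (diverge i (G i) Hi) in Hy; [easy | apply HG | apply HG].
Qed.

(** One element is added for each colour of [S], which makes the sets infinite in the limit. *)
Lemma growth_step J S F X n :
  condition J F X ->
  (forall i, In i S -> exists x, n <= x /\ X x = true /\ J x = i) ->
  exists F', condition J F' X /\ extends F' X F X /\
    forall i, In i S -> exists x, n <= x /\ Nat.testbit (F' i) x = true.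
Proof.
  intros (FX & UX & CF) H.
  destruct (functional_choice (fun i x => In i S -> n <= x /\ X x = true /\ J x = i))
    as [w Hw].
  { intro i; destruct (in_dec Nat.eq_dec i S) as [Hi|Hi];
      [destruct (H i Hi) as [x Hx]; now exists x | now exists 0]. }
  exists (fun i => if in_dec Nat.eq_dec i S then Nat.setbit (F i) (w i) else F i).
  split; [|split; [split; [auto|]|]].
  - split; [auto|]; split; [auto|]; intros i x.
    destruct (in_dec Nat.eq_dec i S) as [Hi|]; [|apply CF].
    rewrite Nat.setbit_eqb, orb_true_iff; intros [<-%Nat.eqb_eq|]; [|now apply CF].
    now apply Hw.
  - intros i x; destruct (in_dec Nat.eq_dec i S) as [Hi|]; [|auto].
    rewrite Nat.setbit_eqb, orb_true_iff; split; [auto|].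
    intros [<-%Nat.eqb_eq|]; [right; now apply Hw | auto].
  - intros i Hi; exists (w i); split; [now apply Hw|].
    destruct (in_dec Nat.eq_dec i S); [|easy].
    now rewrite Nat.setbit_eqb, Nat.eqb_refl.
Qed.

Lemma extends_trans F1 X1 F2 X2 F3 X3 :
  extends F1 X1 F2 X2 -> extends F2 X2 F3 X3 -> extends F1 X1 F3 X3.
Proof.
  intros [A1 B1] [A2 B2]; split; [auto|]; intros i x.
  destruct (B1 i x), (B2 i x); split; [auto|]; intuition.
Qed.

(** Lets one number list a program for every colour of [S], so that requirements are indexed by
    numbers. *)
Fixpoint entry (l i : nat) : nat :=
  match i with 0 => π1 l | S i => entry (π2 l) i end.

Lemma entry_surjective N : forall v, exists l, forall i, i < N -> entry l i = v i.
Proof.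
  induction N as [|N IH]; intro v; [exists 0; lia|].
  destruct (IH (fun i => v (S i))) as [l Hl]; exists ⟨v 0, l⟩.
  intros [|i] L; cbn; proj; [easy | apply Hl; lia].
Qed.

(** Stage [n = ⟨j, l⟩] first adds elements that are at least [n], then, if [j] is a colour, meets
    the requirement for [j] and the programs listed by [l]. [G i] is the union of the finite
    sets. *)
Lemma generic_family c k J S X :
  (forall f j, comp (fun _ => false) f -> 1 <= j <= k ->
    exists x, forall y, x <= y <= f x -> c y = j) ->
  hyperimmune_free X -> unbounded X -> (forall x, X x = true -> In (J x) S) ->
  (forall Y, hyperimmune_free Y -> unbounded Y -> (forall x, Y x = true -> X x = true) ->
    forall i, In i S -> forall n, exists x, n <= x /\ Y x = true /\ J x = i) ->
  exists G : nat -> nat -> bool,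
    (forall i x, G i x = true -> J x = i) /\
    (forall i, In i S -> unbounded (G i)) /\
    forall j (e : nat -> code), 1 <= j <= k -> exists i, In i S /\ avoids c j (e i) (G i).
Proof.
  intros escape FX UX CX minX.
  destruct encode_surjection as [d Hd].
  set (good p := condition J (fst p) (snd p) /\ forall x, snd p x = true -> X x = true).
  (* The relation is conditional on [good p], so that every pair has a successor, as dependent
     choice demands. *)
  destruct (dependent_choice (fun n p p' => good p -> good p' /\
    extends (fst p') (snd p') (fst p) (snd p) /\
    (forall i, In i S -> exists x, n <= x /\ Nat.testbit (fst p' i) x = true) /\
    (1 <= π1 n <= k -> forall G, between (fst p') (snd p') G ->
      exists i, In i S /\ avoids c (π1 n) (d (entry (π2 n) i)) (G i)))
    (fun _ => 0, X)) as (p & p0 & Hp).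
  { intros n [F Y]; destruct (classic (good (F, Y))) as [[C SY]|N]; [|exists (F, Y); easy].
    cbn [fst snd] in *.
    destruct (growth_step J S F Y n C) as (F1 & C1 & E1 & G1).
    { intros i Hi; destruct C as (FY & UY & _); now apply minX. }
    destruct (classic (1 <= π1 n <= k)) as [Hn|Hn].
    - destruct (requirement_step c (π1 n) J S F1 Y (fun i => d (entry (π2 n) i)))
        as (F2 & Y2 & C2 & E2 & R2); auto.
      exists (F2, Y2); cbn [fst snd]; intros _; split; [split|split; [|split]].
      + exact C2.
      + intros x Hx; apply SY, (proj1 E2), Hx.
      + exact (extends_trans _ _ _ _ _ _ E2 E1).
      + intros i Hi; destruct (G1 i Hi) as (x & L & Hx); exists x; split; [exact L|].
        now apply E2.
      + intros _; exact R2.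
    - exists (F1, Y); cbn [fst snd]; intros _; repeat (split; [assumption|]); easy. }
  assert (good0 : good (p 0)).
  { rewrite p0; split; [split; [|split]|]; cbn; auto.
    intros i x; now rewrite Nat.bits_0. }
  assert (goodp : forall n, good (p n)) by (induction n; [auto | now apply Hp]).
  assert (ext : forall m n, extends (fst (p (m + n))) (snd (p (m + n)))
    (fst (p n)) (snd (p n))).
  { induction m as [|m IH]; intro n; [split; [auto | intros; split; auto]|].
    eapply extends_trans; [|apply IH]; now apply (Hp (m + n)). }
  set (G i x := if excluded_middle_informative
    (exists n, Nat.testbit (fst (p n) i) x = true) then true else false).
  assert (HG : forall i x, G i x = true <-> exists n, Nat.testbit (fst (p n) i) x = true).
  { intros i x; unfold G; destruct (excluded_middle_informative _); easy. }
  (* Whatever enters after stage [n] comes from the reservoir of stage [n]. *)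
  assert (bet : forall n, between (fst (p n)) (snd (p n)) G).
  { intros n i x; rewrite HG; split; [eauto|]; intros [m Hm].
    destruct (Nat.le_ge_cases m n) as [L|L].
    - left; replace n with (n - m + m) by lia; now apply ext.
    - replace m with (m - n + n) in Hm by lia; now apply ext in Hm. }
  exists G; split; [|split].
  - intros i x [n Hn]%HG; now apply (goodp n).
  - intros i Hi n; destruct (Hp n (goodp n)) as (_ & _ & grow & _).
    destruct (grow i Hi) as (x & L & Hx); exists x; rewrite HG; eauto.
  - intros j e Hj; destruct (list_bound (fun i => i) S) as [N HN].
    destruct (entry_surjective N (fun i => encode (e i))) as [l Hl].
    destruct (Hp ⟨j, l⟩ (goodp _)) as (_ & _ & _ & req); proj.
    destruct (req Hj G (bet _)) as (i & Hi & A).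
    exists i; split; [exact Hi|]; now rewrite Hl, Hd in A by auto.
Qed.

(** * Computed solutions and the conclusion *)

Lemma infinite_unbounded H n : infinite H -> exists x, n <= x /\ H x.
Proof.
  intro I; apply NNPP; intro N; apply I; exists (seq 0 n); intros x Hx.
  apply in_seq; apply NNPP; intro L; apply N; exists x; split; [lia | exact Hx].
Qed.

(** Searching [H] upwards from [x] gives an element [f x >= x], and all these elements share one
    colour [a]. *)
Lemma computed_solution_not_avoided c H G :
  RT1_solution c H -> turing_le H (fun x => G x = true) ->
  exists a, forall j, j <> a -> exists e, ~ avoids c j e G.
Proof.
  intros [IH CH] [e He].
  destruct (char_bool H) as (h & Eh & Hh).
  destruct (comp_mu G (fun x y => (x <=? y) && h y)) as (f & [d Hd] & Hf).
  - apply dec_and.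
    + apply dec_le; auto using comp_pi1, comp_pi2, comp_id.
    + apply (comp_comp G (fun y => Nat.b2n (h y)) (fun q => π2 q)); [|apply comp_snd].
      exists e; intro x; apply He; rewrite Eh; unfold oracle, char.
      destruct (h x); [now left | now right].
  - intro x; destruct (infinite_unbounded H x IH) as (y & L & Hy).
    exists y; rewrite andb_true_iff, Nat.leb_le, <- Hh; auto.
  - assert (Hf' : forall x, x <= f x /\ H (f x)).
    { intro x; specialize (Hf x); now rewrite andb_true_iff, Nat.leb_le, <- Hh in Hf. }
    exists (c (f 0)); intros j Hj; exists d; intro A; apply A; intro x.
    exists (f x); split; [apply Hf'|]; split; [apply Hd|].
    rewrite (CH (f x) (f 0)); [congruence | apply Hf' | apply Hf'].
Qed.

(** Otherwise the [k] distinct numbers of [seq 1 k] would all lie in [l]. *)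
Lemma avoid_colors k l : length l < k -> exists j, 1 <= j <= k /\ ~ In j l.
Proof.
  intro L; apply NNPP; intro N.
  enough (k <= length l) by lia.
  rewrite <- (length_seq k 1) at 1; apply NoDup_incl_length; [apply seq_NoDup|].
  intros j Hj%in_seq; apply NNPP; intro K; apply N; exists j; split; [lia | exact K].
Qed.

Theorem theorem3 (k : nat) (hk : 2 <= k) :
  exists I : nat -> nat,
    RT1_instance k I /\
    computable_in halting_problem (fun x y => I x = y) /\
    forall J : nat -> nat, RT1_instance (k - 1) J ->
      exists G : nat -> Prop,
        RT1_solution J G /\
        forall H : nat -> Prop, RT1_solution I H -> ~ turing_le H G.
Proof.
  destruct (escaping_coloring k) as (c & Hc & range & escape); [lia|].
  exists c; split; [exact range|]; split; [exact Hc|]; intros J HJ.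
  destruct (minimal_reservoir J (k - 1) HJ) as (S & X & LS & FX & UX & CX & minX).
  destruct (generic_family c k J S X escape FX UX CX minX) as (G & homog & unb & avoid).
  apply NNPP; intro N.
  (* Under [N] every [G i] with [i] in [S] computes a solution, and [a] is its colour; [0] is a
     default outside [S]. *)
  assert (computed : forall i, exists a, In i S ->
    forall j, j <> a -> exists e, ~ avoids c j e (G i)).
  { intro i; destruct (in_dec Nat.eq_dec i S) as [Hi|Hi]; [|now exists 0].
    apply NNPP; intro K; apply N; exists (fun x => G i x = true); split; [split|].
    - intros [l Hl]; destruct (list_bound (fun x => x) l) as [m Hm].
      destruct (unb i Hi m) as (x & L & Hx); specialize (Hm x (Hl x Hx)); lia.
    - intros x y Hx%homog Hy%homog; congruence.
    - intros H solH le; apply K.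
      destruct (computed_solution_not_avoided c H (G i) solH le) as [a Ha]; eauto. }
  destruct (functional_choice _ computed) as [a Ha].
  (* [S] has at most [k - 1] elements, so some colour [j] differs from every [a i]; each [G i] then
     has a program defeating [avoids] for this same [j]. *)
  destruct (avoid_colors k (map a S)) as (j & Hj & Nj); [rewrite length_map; lia|].
  assert (programs : forall i, exists e, In i S -> ~ avoids c j e (G i)).
  { intro i; destruct (in_dec Nat.eq_dec i S) as [Hi|Hi]; [|now exists cZero].
    destruct (Ha i Hi j) as [e He]; [|eauto].
    intros ->; apply Nj, in_map, Hi. }
  destruct (functional_choice _ programs) as [e He].
  destruct (avoid j e Hj) as (i & Hi & A); exact (He i Hi A).
Qed.
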